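(* Let $F$ be a field, $A$ a free abelian group with basis $\{x_1,\dots,x_n\}$, $F * A$ a twisted group algebra, and $M$ a finitely generated $F * A$-module with $\mathrm{gk}(M)=r$, where $0<r\le n-1$. Suppose $M$ is not torsion as an $F * \langle x_1,\dots,x_r\rangle$-module. Then there exist $l_{r+1},\dots,l_n\in\langle x_1,\dots,x_r\rangle$ and nonzero integers $s_{r+1},\dots,s_n$ such that the elements $\bar l_j\bar x_j^{s_j}$ and $\bar l_k\bar x_k^{s_k}$ of $F * A$ commute for all $j,k\in\{r+1,\dots,n\}$.
   Context: A twisted group algebra $F * A$ is an $F$-algebra with $F$-basis $\{\bar a: a\in A\}$ and multiplication $\bar a_1\bar a_2=\tau(a_1,a_2)\overline{a_1a_2}$, $\tau$ a 2-cocycle with values in $F\setminus\{0\}$; $F * B$ is the subalgebra spanned by $\bar b$, $b\in B$. A module is torsion over $F * B$ if every element is annihilated by a nonzero element of $F * B$. $\mathrm{gk}$ denotes Gelfand–Kirillov dimension over $F$. *)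

(* Defs.v *)
From HB Require Import structures.
From mathcomp Require Import all_boot all_order all_algebra.
From mathcomp Require Import boolp classical_sets reals ereal sequences exp Rstruct.
Set Implicit Arguments. Unset Strict Implicit. Unset Printing Implicit Defensive.
Import Order.TTheory GRing.Theory Num.Theory.
Local Open Scope ring_scope.

(* The free abelian group A with basis x_1..x_n is modelled additively as
   'rV[int]_n, with x_(i+1) = xgen i the i-th standard unit vector
   (0-indexed: x_1 = xgen 0). *)
Definition xgen (n : nat) (i : 'I_n) : 'rV[int]_n := delta_mx 0 i.

(* a \in <x_1, ..., x_r>  (indices 0 .. r-1 in 0-indexed form) *)
Definition in_first (n r : nat) (a : 'rV[int]_n) : Prop :=
  forall i : 'I_n, (r <= i)%N -> a 0 i = 0.

Definition is_twisted_group_algebra (F : fieldType) (n : nat)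
  (FA : unitAlgType F) (tau : 'rV[int]_n -> 'rV[int]_n -> F)
  (bar : 'rV[int]_n -> FA) : Prop :=
  [/\ (forall a b, tau a b != 0),
      (forall a b c, tau a b * tau (a + b) c = tau b c * tau a (b + c)),
      (forall a b, bar a * bar b = tau a b *: bar (a + b)),
      (forall (s : seq 'rV[int]_n) (c : 'rV[int]_n -> F), uniq s ->
         \sum_(a <- s) c a *: bar a = 0 -> forall a, a \in s -> c a = 0) &
      (forall x : FA, exists (s : seq 'rV[int]_n) (c : 'rV[int]_n -> F),
         x = \sum_(a <- s) c a *: bar a)].

Definition in_sub_tga (F : fieldType) (n : nat) (FA : unitAlgType F)
  (bar : 'rV[int]_n -> FA) (P : 'rV[int]_n -> Prop) (y : FA) : Prop :=
  exists (s : seq 'rV[int]_n) (c : 'rV[int]_n -> F),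
    (forall a, a \in s -> P a) /\ y = \sum_(a <- s) c a *: bar a.

Definition torsion_over (F : fieldType) (n : nat) (FA : unitAlgType F)
  (bar : 'rV[int]_n -> FA) (M : lmodType FA) (P : 'rV[int]_n -> Prop) : Prop :=
  forall m : M, exists y : FA, [/\ in_sub_tga bar P y, y != 0 & y *: m = 0].

Definition fin_gen (FA : nzRingType) (M : lmodType FA) : Prop :=
  exists g : seq M, forall m : M, exists c : nat -> FA,
    m = \sum_(i < size g) c i *: g`_i.

Section GK.
Variables (F : fieldType) (FA : unitAlgType F) (M : lmodType FA).

Definition fscale (c : F) (m : M) : M := (c%:A : FA) *: m.

Definition findep (t : seq M) : Prop :=
  forall c : nat -> F, \sum_(i < size t) fscale (c i) t`_i = 0 ->
    forall i, (i < size t)%N -> c i = 0.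

(* F-dimension of the F-span of a finite family: the maximal size of an
   F-linearly independent subfamily *)
Definition fdim (t : seq M) : nat :=
  \max_(m : (size t).-tuple bool | `[< findep (mask m t) >]) size (mask m t).

(* all products v_1 * ... * v_k with v_i in V; they span V^k *)
Fixpoint words (V : seq FA) (k : nat) : seq FA :=
  if k is k'.+1 then [seq v * u | v <- V, u <- words V k'] else [:: 1].

(* a spanning family of V^k W *)
Definition VkW (V : seq FA) (W : seq M) (k : nat) : seq M :=
  [seq u *: w | u <- words V k, w <- W].

Definition gk_ratio (V : seq FA) (W : seq M) (k : nat) : \bar Rdefinitions.R :=
  ((ln ((fdim (VkW V W k))%:R : Rdefinitions.R)) / ln (k%:R : Rdefinitions.R))%:E.

(* Gelfand--Kirillov dimension of M over F:
   sup over finite-dimensional subspaces V of FA containing 1 (given by a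
   finite spanning family V with 1 in V) and finite-dimensional subspaces W
   of M (spanned by W) of limsup_k log dim(V^k W) / log k. *)
Definition gkdim : \bar Rdefinitions.R :=
  ereal_sup [set x | exists (V : seq FA) (W : seq M),
                       (1 \in V) /\ x = limn_esup (gk_ratio V W)].
End GK.

(* Main.v *)
Require Import Defs.
From HB Require Import structures.
From mathcomp Require Import all_boot all_order all_algebra.
From mathcomp Require Import zify lra.
From mathcomp Require Import boolp classical_sets reals ereal sequences exp Rstruct.
Import Order.TTheory GRing.Theory Num.Theory.
Local Open Scope ring_scope.
Set Implicit Arguments.
Unset Strict Implicit.
Unset Printing Implicit Defensive.

(** Write [B = <x_1, ..., x_r>].  Some [m] in [M] generates a free [F*B]-module;
    let [I] be a left ideal containing its annihilator and maximal subject to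
    [I :&: F*B = 0].  As [gk M < r + 1], the [F*B]-rank of [F*A / I] is finite.
    Embed [B] in the positive rationals, so that it is ordered and archimedean.
    For a monoid [P] of [A] containing the non-positive part of [B], consider the
    [P]-stable subspaces [L] of [F*A] containing [I], and let [m L] be the union of
    the [b L] with [b < 0] in [B].  The dimension of [L / m L] is bounded by the
    rank and is modular in [L], so the [L] of maximal dimension are closed under
    sums and translations; by maximality of [I] this forces the following: if [1]
    is not in [m J(P)], where [J(P) = F*P + I], then no finite sum [E] of
    translates of [J(P)] satisfies [E = m E].  Hence, as in Chevalley's extension
    theorem for valuations, a maximal [P] with [1] not in [m J(P)] is total:
    [a] or [- a] lies in [P] for every [a] in [A].  Finiteness of the rank shows
    that every [a] has a positive multiple in [B + C], where [C] consists of the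
    [c] with [c] and [- c] both in [P].  Finally [C] acts on the nonzero
    finite-dimensional space [J(P) / m J(P)], and determinants show that the
    commutator scalars of [C] are roots of unity of order dividing its dimension. *)

(** * Finite linear systems, counting in boxes, powers and Zorn's lemma *)

Lemma seq_max (T : eqType) (R : T -> T -> Prop) (s : seq T) :
  (forall x, R x x) -> (forall x y z, R x y -> R y z -> R x z) ->
  (forall x y, R x y \/ R y x) -> s != [::] ->
  exists2 x, x \in s & forall y, y \in s -> R y x.
Proof.
move=> Rxx Rtr Rtot; elim: s => // x s IH _.
have [->|/IH[m ms mP]] := eqVneq s [::].
  by exists x => [|y]; rewrite inE // => /eqP ->.
have [xm|mx] := Rtot x m.
  exists m => [|y]; first by rewrite inE ms orbT.
  by rewrite inE => /orP[/eqP -> //|/mP].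
exists x => [|y]; first by rewrite inE eqxx.
by rewrite inE => /orP[/eqP -> //|/mP ym]; apply: Rtr ym mx.
Qed.

Lemma wide_system (F : fieldType) (T1 T2 : finType) (M : T1 -> T2 -> F) : (#|T2| < #|T1|)%N ->
  exists2 x : T1 -> F, exists t, x t != 0 & forall u, \sum_t x t * M t u = 0.
Proof.
move=> lt; pose B : 'M_(#|T1|, #|T2|) := \matrix_(i, j) M (enum_val i) (enum_val j).
have K0 : kermx B != 0.
  rewrite kermx_eq0 /row_free neq_ltn; apply/orP; left.
  exact: leq_ltn_trans (rank_leq_col B) lt.
have := nz_row_sub (kermx B); move/sub_kermxP => vB.
exists (fun t => nz_row (kermx B) 0 (enum_rank t)).
  have /rV0Pn[i vi] : nz_row (kermx B) != 0 by rewrite nz_row_eq0.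
  by exists (enum_val i); rewrite enum_valK.
move=> u; have /rowP/(_ (enum_rank u)) := vB; rewrite !mxE => vu.
rewrite -[RHS]vu [LHS](reindex _ (onW_bij _ (enum_val_bij T1))); apply: eq_bigr => i _.
by rewrite !mxE enum_valK enum_rankK.
Qed.

(** The quotient [(k + d)^r / k^r] tends to [1]. This lets linear algebra over [F] on large boxes of
    [B] solve linear systems over F*B. *)
Lemma box_growth (q r d : nat) : exists k : nat, (q * (k + d) ^ r < q.+1 * k ^ r)%N.
Proof.
(* With [m = k + d] this reads [m (m^r - k^r) <= r d m^r], so any [k] with [m > (q + 1) r d] will
   do. *)
have key k : ((k + d) * (k + d) ^ r <= (k + d) * k ^ r + r * d * (k + d) ^ r)%N.
  elim: r => [|r IH]; first by rewrite !expn0 mul0n addn0.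
  rewrite !expnS; set m := (k + d)%N in IH *.
  have le : (k ^ r <= m ^ r)%N by case: {IH}r => // r; rewrite leq_exp2r ?leq_addr.
  nia.
exists (q.+1 * r * d + 1)%N; set k := (q.+1 * r * d + 1)%N.
have := key k; have : (0 < (k + d) ^ r)%N by rewrite expn_gt0 addn_gt0 /k addn1.
have : (q.+1 * r * d < k + d)%N by rewrite /k; lia.
move: ((k + d) ^ r)%N (k ^ r)%N (k + d)%N => M K m; nia.
Qed.

(** Subspaces are handled as predicates; a matrix of maximal rank with row space inside [S] makes
    ranks and complements available. *)
Lemma subspace_rowspace (F : fieldType) N (S : 'rV[F]_N -> Prop) : S 0 ->
  (forall (k : F) u v, S u -> S v -> S (k *: u + v)) ->
  exists B : 'M[F]_N, forall v, S v <-> (v <= B)%MS.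
Proof.
move=> S0 Slin; pose ok (B : 'M[F]_N) := forall v : 'rV_N, (v <= B)%MS -> S v.
have ex : exists k, `[< exists2 B, ok B & \rank B = k >].
  exists 0%N; apply/asboolP; exists 0; last exact: mxrank0.
  by move=> v; rewrite submx0 => /eqP ->.
have bd k : `[< exists2 B, ok B & \rank B = k >] -> (k <= N)%N.
  by case/asboolP => B _ <-; exact: rank_leq_row.
case: (ex_maxnP ex bd) => k /asboolP[B okB rB] kmax; exists B => v.
split=> [Sv|/okB //]; apply/negPn/negP => nv.
suff : (\rank (B + v)%MS <= k)%N.
  rewrite -rB leqNgt => /negP; apply; apply: rank_ltmx.
  rewrite ltmxE addsmxSl /=; apply: contra nv; exact: submx_trans (addsmxSr B v).
apply: kmax; apply/asboolP; exists (B + v)%MS => // w /sub_addsmxP[[u1 u2] /= ->].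
by rewrite [u2]mx11_scalar mul_scalar_mx addrC; apply: Slin => //; apply/okB/submxMl.
Qed.

Lemma expn_small (x y : rat) : 0 < x -> x < 1 -> 0 < y -> exists k : nat, x ^+ k <= y.
Proof.
move=> x0 x1 y0; pose d := x^-1 - 1.
have d0 : 0 < d by rewrite subr_gt0 invf_gt1.
have bern k : 1 + k%:R * d <= x^-1 ^+ k.
  elim: k => [|k IH]; first by rewrite mul0r addr0 expr0.
  have xv : x^-1 = 1 + d by rewrite /d addrC subrK.
  have kd : 0 <= k%:R * d by rewrite mulr_ge0 ?ler0n // ltW.
  rewrite exprS {1}xv -natr1; nra.
have yd : 0 <= y^-1 / d by rewrite divr_ge0 ?invr_ge0 ?ltW.
exists (Num.bound (y^-1 / d)).
have := archi_boundP yd; set k := Num.bound _; rewrite ltr_pdivrMr // => /ltW h.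
rewrite -[x ^+ k]invrK -[y]invrK lef_pV2 ?posrE ?invr_gt0 ?exprn_gt0 // -exprVn.
by apply: le_trans h (le_trans _ (bern k)); rewrite lerDr.
Qed.

Lemma Zorn_nonempty (T : Type) (good : set (set T)) : (exists X, good X) ->
  (forall C : set (set T), (C `<=` good)%classic -> total_on C subset ->
     (exists X, C X) -> good (\bigcup_(X in C) X)%classic) ->
  exists2 X, good X & forall Y, good Y -> (X `<=` Y -> Y `<=` X)%classic.
Proof.
move=> [X0 g0] chain.
have [|X [gX Xmax]] := @Zorn_bigcup T (fun X => good X \/ X = set0).
  move=> C Cg Ctot; have [[X [CX gX]]|h] := pselect (exists X, C X /\ good X).
    left; pose C' X := C X /\ good X.
    have -> : (\bigcup_(X in C) X = \bigcup_(X in C') X)%classic.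
      apply/seteqP; split=> [x [Y CY Yx]|x [Y [CY gY] Yx]]; last by exists Y.
      by case: (Cg _ CY) => gY; [exists Y|move: Yx; rewrite gY].
    apply: chain => [Y []//|Y Z [CY _] [CZ _]|]; first exact: Ctot.
    by exists X.
  right; apply/seteqP; split=> // x [Y CY Yx].
  by case: (Cg _ CY) => gY; [case: h; exists Y|move: Yx; rewrite gY].
have max Y : good Y -> (X `<=` Y -> Y `<=` X)%classic.
  move=> gY XY; apply: contrapT => nYX; apply: (Xmax Y); last by left.
  by split.
exists X => //; case: gX => // X0'; suff -> : X = X0 by [].
by apply/seteqP; split; [rewrite X0'|apply: max; rewrite ?X0'].
Qed.

(** * Coordinates and supports *)

Section TwistedGroupAlgebra.
Variables (F : fieldType) (n : nat) (FA : unitAlgType F).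
Variables (tau : 'rV[int]_n -> 'rV[int]_n -> F) (bar : 'rV[int]_n -> FA).
Hypothesis tga : is_twisted_group_algebra tau bar.
Local Notation A := 'rV[int]_n.
Implicit Types (a b c : A) (y z u : FA) (Q P : A -> Prop) (K L : FA -> Prop).

Lemma tau_neq0 a b : tau a b != 0. Proof. by case: tga. Qed.

Lemma barM a b : bar a * bar b = tau a b *: bar (a + b).
Proof. by case: tga. Qed.

Lemma bar_free (s : seq A) (k : A -> F) : uniq s ->
  \sum_(a <- s) k a *: bar a = 0 -> forall a, a \in s -> k a = 0.
Proof. by case: tga => _ _ _ h _; apply: h. Qed.

Lemma sum_bar_widen (s t : seq A) (k : A -> F) : uniq s -> uniq t ->
  {subset s <= t} -> (forall a, a \notin s -> k a = 0) ->
  \sum_(a <- t) k a *: bar a = \sum_(a <- s) k a *: bar a.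
Proof.
move=> us ut st k0; rewrite (bigID (mem s)) /= [X in _ + X]big1 => [|a ns].
  rewrite addr0 -big_filter; apply: perm_big; apply: uniq_perm => //.
    exact: filter_uniq.
  by move=> a; rewrite mem_filter /=; apply: andb_idr; apply: st.
by rewrite k0 // scale0r.
Qed.

(** The list given by the spanning axiom may repeat indices; each coefficient is multiplied by the
    multiplicity of its index, which also makes it vanish off the list. *)
Lemma coef_ex y : exists p : seq A * (A -> F),
  [/\ uniq p.1, forall a, a \notin p.1 -> p.2 a = 0
    & y = \sum_(a <- p.1) p.2 a *: bar a].
Proof.
case: tga => _ _ _ _ /(_ y) [s [k ->]].
exists (undup s, fun a => k a *+ count_mem a s); split=> /=.
- exact: undup_uniq.
- by move=> a; rewrite mem_undup => /count_memPn ->.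
- rewrite -[LHS]big_undup_iterop_count; apply: eq_bigr => a _ /=.
  by rewrite -scalerMnl.
Qed.

Definition coef y : A -> F := (sval (cid (coef_ex y))).2.
Definition supp y : seq A := (sval (cid (coef_ex y))).1.

Lemma supp_uniq y : uniq (supp y).
Proof. by rewrite /supp; case: cid => p []. Qed.

Lemma coef_out y a : a \notin supp y -> coef y a = 0.
Proof. by rewrite /supp /coef; case: cid => p [] ? h ?; apply: h. Qed.

Lemma coefE y : y = \sum_(a <- supp y) coef y a *: bar a.
Proof. by rewrite /supp /coef; case: cid => p []. Qed.

Lemma coef_unique (s : seq A) (k : A -> F) y : uniq s ->
  (forall a, a \notin s -> k a = 0) -> y = \sum_(a <- s) k a *: bar a ->
  coef y =1 k.
Proof.
move=> us k0 yE a.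
pose t := undup (s ++ supp y); have ut : uniq t by apply: undup_uniq.
have : \sum_(a <- t) (coef y a - k a) *: bar a = 0.
  under eq_bigr do rewrite scalerBl.
  rewrite sumrB (@sum_bar_widen (supp y)) ?supp_uniq //; last 2 first.
  - by move=> b bs; rewrite mem_undup mem_cat bs orbT.
  - exact: coef_out.
  rewrite (@sum_bar_widen s t k) -?coefE -?yE ?subrr // => b bs.
  by rewrite mem_undup mem_cat bs.
move/(bar_free ut) => h.
have [at_|] := boolP (a \in t); first by apply/eqP; rewrite -subr_eq0 h.
by rewrite mem_undup mem_cat negb_or => /andP[/k0 -> /coef_out ->].
Qed.

Lemma coef_linear (k : F) y z a : coef (k *: y + z) a = k * coef y a + coef z a.
Proof.
pose t := undup (supp y ++ supp z); have ut : uniq t by apply: undup_uniq.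
move: a; apply: (@coef_unique t) => // [a|].
  rewrite mem_undup mem_cat negb_or => /andP[/coef_out -> /coef_out ->].
  by rewrite mulr0 addr0.
rewrite {1}[y]coefE {1}[z]coefE scaler_sumr.
under [RHS]eq_bigr do rewrite scalerDl -scalerA.
rewrite big_split /= -!scaler_sumr (@sum_bar_widen (supp y) t (coef y)) ?supp_uniq //.
- rewrite (@sum_bar_widen (supp z) t (coef z)) ?supp_uniq //.
    by move=> b bs; rewrite mem_undup mem_cat bs orbT.
  exact: coef_out.
- by move=> b bs; rewrite mem_undup mem_cat bs.
- exact: coef_out.
Qed.

Lemma coef0 a : coef 0 a = 0.
Proof.
by apply: (@coef_unique [::] (fun=> 0)) => //; rewrite big_nil.
Qed.

Lemma coefZ (k : F) y a : coef (k *: y) a = k * coef y a.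
Proof. by rewrite -[k *: y]addr0 coef_linear coef0 addr0. Qed.

Lemma coefD y z a : coef (y + z) a = coef y a + coef z a.
Proof. by rewrite -[y]scale1r coef_linear coefZ. Qed.

Lemma coef_sum (I : Type) (s : seq I) (f : I -> FA) a :
  coef (\sum_(i <- s) f i) a = \sum_(i <- s) coef (f i) a.
Proof.
by apply: (big_morph (fun y => coef y a)) => [y z|]; rewrite ?coefD ?coef0.
Qed.

Lemma coef_bar a b : coef (bar a) b = (b == a)%:R.
Proof.
apply: (@coef_unique [:: a] (fun b => (b == a)%:R)) => //.
  by move=> {}b; rewrite inE => /negPf ->.
by rewrite big_seq1 eqxx scale1r.
Qed.

Lemma coef_inj y z : (forall a, coef y a = coef z a) -> y = z.
Proof.
move=> h; rewrite [y]coefE [z]coefE.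
pose t := undup (supp y ++ supp z); have ut : uniq t by apply: undup_uniq.
rewrite -(@sum_bar_widen (supp y) t) ?supp_uniq //; last 2 first.
- by move=> b bs; rewrite mem_undup mem_cat bs.
- exact: coef_out.
rewrite -(@sum_bar_widen (supp z) t) ?supp_uniq //; last 2 first.
- by move=> b bs; rewrite mem_undup mem_cat bs orbT.
- exact: coef_out.
by apply: eq_bigr => a _; rewrite h.
Qed.

Lemma neq0_coef y : y != 0 -> exists a, coef y a != 0.
Proof.
move=> y0; apply: contrapT => h; case/eqP: y0; apply: coef_inj => a.
by rewrite coef0; apply/eqP/negPn/negP => ha; apply: h; exists a.
Qed.

Lemma coef_barMl b y a : coef (bar b * y) a = tau b (a - b) * coef y (a - b).
Proof.
rewrite {1}[y]coefE mulr_sumr coef_sum.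
under eq_bigr do rewrite -scalerAr barM !coefZ coef_bar.
have [ain|aout] := boolP (a - b \in supp y); last first.
  rewrite coef_out // mulr0 big_seq big1 // => c cs.
  suff /negPf -> : a != b + c by rewrite !mulr0.
  by apply: contraNneq aout => ->; rewrite addrC addKr.
rewrite (bigD1_seq _ ain) ?supp_uniq //= big1 => [|c cn].
  by rewrite addr0 [b + _]addrC subrK eqxx mulr1 mulrC.
suff /negPf -> : a != b + c by rewrite !mulr0.
by apply: contraNneq cn => ->; rewrite addrC addKr.
Qed.

Lemma coef_barMr b y a : coef (y * bar b) a = tau (a - b) b * coef y (a - b).
Proof.
rewrite {1}[y]coefE mulr_suml coef_sum.
under eq_bigr do rewrite -scalerAl barM !coefZ coef_bar.
have [ain|aout] := boolP (a - b \in supp y); last first.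
  rewrite coef_out // mulr0 big_seq big1 // => c cs.
  suff /negPf -> : a != c + b by rewrite !mulr0.
  by apply: contraNneq aout => ->; rewrite addrK.
rewrite (bigD1_seq _ ain) ?supp_uniq //= big1 => [|c cn].
  by rewrite subrK eqxx addr0 mulr1 mulrC.
suff /negPf -> : a != c + b by rewrite !mulr0.
by apply: contraNneq cn => ->; rewrite addrK.
Qed.

Lemma tau0 c : tau 0 c = tau 0 0.
Proof.
case: tga => t0 h _ _ _; have := h 0 0 c; rewrite !add0r => /mulIf -> //.
Qed.

(** The cocycle is not normalised, so [1] is only a multiple of [bar 0]; this is the source of the
    factors [tau 0 0] in the cancellation rules below. *)
Lemma bar0 : bar 0 = (tau 0 0)%:A.
Proof.
have h y : bar 0 * y = tau 0 0 *: y.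
  by apply: coef_inj => a; rewrite coef_barMl coefZ tau0 subr0.
by rewrite -[LHS]mulr1 h.
Qed.

(** For a submonoid [Q] this is the twisted monoid algebra F*Q; in general it is only a subspace. *)
Definition inFS Q y := forall a, coef y a != 0 -> Q a.

Definition subsp K := K 0 /\ forall (k : F) y z, K y -> K z -> K (k *: y + z).

Lemma subspZ K (k : F) y : subsp K -> K y -> K (k *: y).
Proof. by case=> K0 h Ky; rewrite -[k *: y]addr0; apply: h. Qed.

Lemma subspD K y z : subsp K -> K y -> K z -> K (y + z).
Proof. by case=> K0 h Ky Kz; rewrite -[y]scale1r; apply: h. Qed.

Lemma subspN K y : subsp K -> K y -> K (- y).
Proof. by move=> sK Ky; rewrite -scaleN1r; apply: subspZ. Qed.

Lemma subspB K y z : subsp K -> K y -> K z -> K (y - z).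
Proof. by move=> sK Ky Kz; apply: subspD => //; apply: subspN. Qed.

Lemma subspZV K (k : F) y : subsp K -> k != 0 -> K (k *: y) -> K y.
Proof.
by move=> sK k0 /(subspZ k^-1 sK); rewrite scalerA mulVf // scale1r.
Qed.

Lemma subsp_sum K (I : eqType) (s : seq I) (f : I -> FA) : subsp K ->
  (forall i, i \in s -> K (f i)) -> K (\sum_(i <- s) f i).
Proof.
move=> sK h; rewrite big_seq; elim/big_ind: _ => //; first by case: sK.
by move=> *; apply: subspD.
Qed.

Lemma inFS_subsp Q : subsp (inFS Q).
Proof.
split=> [a|k y z Qy Qz a]; first by rewrite coef0 eqxx.
rewrite coef_linear; have [->|ya _] := eqVneq (coef y a) 0; last exact: Qy.
by rewrite mulr0 add0r; apply: Qz.
Qed.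

Lemma inFSZ Q (k : F) y : inFS Q y -> inFS Q (k *: y).
Proof. exact: (subspZ k (@inFS_subsp Q)). Qed.

Lemma inFSD Q y z : inFS Q y -> inFS Q z -> inFS Q (y + z).
Proof. exact: (subspD (@inFS_subsp Q)). Qed.

Lemma inFSB Q y z : inFS Q y -> inFS Q z -> inFS Q (y - z).
Proof. exact: (subspB (@inFS_subsp Q)). Qed.

Lemma inFS_bar Q a : Q a -> inFS Q (bar a).
Proof. by move=> Qa b; rewrite coef_bar; case: (eqVneq b a) => [->|]; rewrite ?eqxx. Qed.

Lemma inFS_ind Q K y : subsp K -> (forall a, Q a -> K (bar a)) -> inFS Q y -> K y.
Proof.
move=> sK h Qy; rewrite [y]coefE; apply: subsp_sum => // a _.
have [->|ya] := eqVneq (coef y a) 0; first by rewrite scale0r; case: sK.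
by apply: subspZ => //; apply/h/Qy.
Qed.

Lemma inFS_sub Q P y : (forall a, Q a -> P a) -> inFS Q y -> inFS P y.
Proof. by move=> h Qy a /Qy /h. Qed.

Lemma in_sub_tgaP Q y : in_sub_tga bar Q y <-> inFS Q y.
Proof.
split=> [[s [k [Qs ->]]]|Qy].
  apply: subsp_sum => [|a /Qs Qa]; first exact: inFS_subsp.
  by apply: inFSZ; exact: inFS_bar.
exists [seq a <- supp y | coef y a != 0], (coef y); split.
  by move=> a; rewrite mem_filter => /andP[/Qy].
rewrite big_filter {1}[y]coefE [RHS]big_mkcond /=; apply: eq_bigr => a _.
by case: eqVneq => //= ->; rewrite scale0r.
Qed.

Lemma subsp_mull K u : subsp K -> subsp (fun y => K (u * y)).
Proof.
case=> K0 h; split; first by rewrite mulr0.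
by move=> k y z Ky Kz; rewrite mulrDr -scalerAr; apply: h.
Qed.

Lemma subsp_mulr K u : subsp K -> subsp (fun y => K (y * u)).
Proof.
case=> K0 h; split; first by rewrite mul0r.
by move=> k y z Ky Kz; rewrite mulrDl -scalerAl; apply: h.
Qed.

Lemma inFSM Q P R y z : (forall a b, Q a -> P b -> R (a + b)) ->
  inFS Q y -> inFS P z -> inFS R (y * z).
Proof.
move=> h Qy Pz; have sR := @inFS_subsp R.
apply: (@inFS_ind Q (fun y => inFS R (y * z))) Qy; first exact: subsp_mulr.
move=> a Qa; apply: (@inFS_ind P (fun z => inFS R (bar a * z))) Pz.
  exact: subsp_mull.
move=> b Pb; rewrite barM; apply: inFSZ.
by apply: inFS_bar; apply: h.
Qed.

Lemma inFS_mulbar Q P b y : (forall a, Q a -> P (b + a)) ->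
  inFS Q y -> inFS P (bar b * y).
Proof.
move=> h Qy a; rewrite coef_barMl mulf_eq0 negb_or => /andP[_ /Qy /h].
by rewrite addrC subrK.
Qed.

Lemma inFS_barmul Q P b y : (forall a, Q a -> P (b + a)) ->
  inFS Q y -> inFS P (y * bar b).
Proof.
move=> h Qy a; rewrite coef_barMr mulf_eq0 negb_or => /andP[_ /Qy /h].
by rewrite addrC subrK.
Qed.

Lemma barMA a b y : bar a * (bar b * y) = tau a b *: (bar (a + b) * y).
Proof. by rewrite mulrA barM scalerAl. Qed.

Lemma barNK a y : bar (- a) * (bar a * y) = (tau (- a) a * tau 0 0) *: y.
Proof. by rewrite barMA addNr bar0 mulr_algl scalerA. Qed.

Lemma barKN a y : bar a * (bar (- a) * y) = (tau a (- a) * tau 0 0) *: y.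
Proof. by rewrite barMA addrN bar0 mulr_algl scalerA. Qed.

Lemma tauM_neq0 a b c d : tau a b * tau c d != 0.
Proof. by rewrite mulf_neq0 ?tau_neq0. Qed.

Lemma bar_comm a b : exists2 k : F, k != 0 & bar a * bar b = k *: (bar b * bar a).
Proof.
exists (tau a b / tau b a); first by rewrite mulf_neq0 ?invr_eq0 ?tau_neq0.
by rewrite !barM scalerA addrC divfK ?tau_neq0.
Qed.

Lemma bar_unit a : bar a \is a GRing.unit.
Proof.
have nz := tauM_neq0 a (- a) 0 0; have nz' := tauM_neq0 (- a) a 0 0.
have l := barNK a 1; have r := barKN a 1; rewrite !mulr1 in l r.
pose u := (tau (- a) a * tau 0 0)^-1 *: bar (- a).
pose v := (tau a (- a) * tau 0 0)^-1 *: bar (- a).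
have ul : u * bar a = 1 by rewrite -scalerAl l scalerA mulVf // scale1r.
have vr : bar a * v = 1 by rewrite -scalerAr r scalerA mulVf // scale1r.
apply/unitrP; exists u; split=> //.
suff -> : u = v by [].
by rewrite -[LHS]mulr1 -vr mulrA ul mul1r.
Qed.

Lemma bar_inv a : exists2 k : F, k != 0 & (bar a)^-1 = k *: bar (- a).
Proof.
exists (tau a (- a) * tau 0 0)^-1; first by rewrite invr_eq0 tauM_neq0.
apply: (mulrI (bar_unit a)); rewrite divrr ?bar_unit // -scalerAr.
by have := barKN a 1; rewrite !mulr1 => ->; rewrite scalerA mulVf ?tauM_neq0 ?scale1r.
Qed.

Lemma bar_neq0 a : bar a != 0.
Proof. by apply: contraTneq (bar_unit a) => ->; rewrite unitr0. Qed.

Lemma barMl_eq0 a y : (bar a * y == 0) = (y == 0).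
Proof. exact: mulrI_eq0 (mulrI (bar_unit a)). Qed.

(** Conjugation by [bar a] preserves supports because [A] is abelian. This replaces commutativity
    wherever a [bar a] must pass an element of F*B. *)
Lemma bar_swap Q a y : inFS Q y ->
  exists z, [/\ inFS Q z, bar a * y = z * bar a & (z == 0) = (y == 0)].
Proof.
move=> Qy; exists (bar a * y * (bar a)^-1); split.
- have [k k0 ->] := bar_inv a; rewrite -scalerAr.
  apply: inFSZ.
  apply: (@inFS_barmul (fun b => Q (b - a))) => [b|]; first by rewrite addrC.
  by apply: inFS_mulbar Qy => b; rewrite addrC addKr.
- by rewrite divrK ?bar_unit.
- by rewrite mulIr_eq0 ?barMl_eq0 //; apply: mulIr; rewrite unitrV bar_unit.
Qed.

Lemma bar_swapV Q a y : inFS Q y ->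
  exists z, [/\ inFS Q z, y * bar a = bar a * z & (z == 0) = (y == 0)].
Proof.
move=> Qy; exists ((bar a)^-1 * (y * bar a)); split.
- have [k k0 ->] := bar_inv a; rewrite -scalerAl.
  apply: inFSZ.
  apply: (@inFS_mulbar (fun b => Q (b - a))) => [b|]; first by rewrite addrC.
  by apply: inFS_barmul Qy => b; rewrite addrC addKr.
- by rewrite mulVKr ?bar_unit.
- rewrite mulrI_eq0 ?mulIr_eq0 //; first exact/mulIr/bar_unit.
  by apply: mulrI; rewrite unitrV bar_unit.
Qed.

Lemma inFS1 Q : Q 0 -> inFS Q 1.
Proof.
move=> Q0; have := inFS_bar Q0; rewrite bar0.
exact: (subspZV (@inFS_subsp Q) (tau_neq0 0 0)).
Qed.

Lemma coef1_0 : coef 1 0 != 0.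
Proof.
have := coef_bar 0 0; rewrite eqxx bar0 coefZ.
by apply: contra_eq_neq => ->; rewrite mulr0 eq_sym oner_eq0.
Qed.
(** * The ordered group [B] and the Ore domain [F*B] *)

Variables (r : nat) (phi : A -> rat).
Hypothesis phiD : forall a b, phi (a + b) = phi a * phi b.
Hypothesis phi_gt0 : forall a, 0 < phi a.
Hypothesis phi_inj : forall b, in_first r b -> phi b = 1 -> b = 0.
Local Notation inB := (in_first r).
Local Notation inFB := (inFS inB).

(** Since [phi] maps sums to products of positive rationals, [b <= 0] in the order on [B] reads
    [phi b <= 1]. *)
Definition nonpos b := inB b /\ phi b <= 1.
Definition neg b := inB b /\ phi b < 1.

Lemma inB0 : inB (0 : A). Proof. by move=> i _; rewrite mxE. Qed.

Lemma inBD a b : inB a -> inB b -> inB (a + b).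
Proof. by move=> ha hb i ri; rewrite mxE ha ?hb ?addr0. Qed.

Lemma inBN a : inB a -> inB (- a).
Proof. by move=> ha i ri; rewrite mxE ha ?oppr0. Qed.

Lemma phi0 : phi 0 = 1.
Proof.
have := phiD 0 0; rewrite addr0 => /eqP.
by rewrite -subr_eq0 -{1}[phi 0]mulr1 -mulrBr mulf_eq0 gt_eqF //= subr_eq0 => /eqP.
Qed.

Lemma phiN a : phi (- a) = (phi a)^-1.
Proof.
have /lt0r_neq0 := phi_gt0 a => nz; apply: (mulfI nz).
by rewrite -phiD subrr phi0 divff.
Qed.

Lemma phiMn a (k : nat) : phi (a *+ k) = phi a ^+ k.
Proof. by elim: k => [|k IH]; rewrite ?mulr0n ?phi0 ?mulrS ?phiD ?exprS ?IH. Qed.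

Lemma neg_nonpos b : neg b -> nonpos b.
Proof. by case=> hb /ltW. Qed.

Lemma nonpos0 : nonpos 0.
Proof. by split; [exact: inB0|rewrite phi0]. Qed.

Lemma neg0 : ~ neg 0.
Proof. by case=> _; rewrite phi0 ltxx. Qed.

Lemma nonposD a b : nonpos a -> nonpos b -> nonpos (a + b).
Proof.
move=> [ha a1] [hb b1]; split; first exact: inBD.
by rewrite phiD mulr_ile1 // ltW.
Qed.

Lemma nonpos_neg a b : nonpos a -> neg b -> neg (a + b).
Proof.
move=> [ha a1] [hb b1]; split; first exact: inBD.
rewrite phiD; apply: le_lt_trans b1; rewrite ler_piMl //; exact: ltW.
Qed.

Lemma nonposVneg b : inB b -> nonpos b \/ neg (- b).
Proof.
move=> hb; have [b1|b1] := leP (phi b) 1; first by left.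
by right; split; [exact: inBN|rewrite phiN invf_lt1].
Qed.

(** Dividing the whole family by the largest [b] occurring in any of its supports leaves scalars
    modulo negative terms, not all zero. This is how relations over F*B are reduced to relations
    over [F]. *)
Lemma leading_term (N : nat) (f : 'I_N -> FA) : (forall i, inFB (f i)) ->
  (exists i, f i != 0) ->
  exists b (k : 'I_N -> F) (m : 'I_N -> FA), [/\ inB b, exists i, k i != 0,
    forall i, inFS neg (m i) & forall i, bar (- b) * f i = k i *: 1 + m i].
Proof.
move=> fB [i0 fi0].
pose s := [seq a <- flatten [seq supp (f i) | i <- enum 'I_N] |
           [exists i, coef (f i) a != 0]].
have sP a i : coef (f i) a != 0 -> a \in s.
  move=> ha; rewrite mem_filter; apply/andP; split; first by apply/existsP; exists i.
  apply/flattenP; exists (supp (f i)).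
    by apply/mapP; exists i; rewrite ?mem_enum.
  by apply: contraNT ha => /coef_out ->.
have s0 : s != [::].
  by have [a /sP as_] := neq0_coef fi0; apply: contraTneq as_ => ->.
have [|||b bs bmax] := @seq_max _ (fun a b => phi a <= phi b) s _ _ _ s0.
- by move=> x; exact: lexx.
- by move=> x y z; exact: le_trans.
- by move=> x y; apply/orP; exact: le_total.
have [i1 hi1] : exists i, coef (f i) b != 0.
  by apply/existsP; move: bs; rewrite mem_filter => /andP[].
have hb : inB b by exact: fB hi1.
(* The division is needed because [coef 1 0] is the inverse of [tau 0 0], not [1]. *)
pose k i := coef (bar (- b) * f i) 0 / coef 1 0.
exists b, k, (fun i => bar (- b) * f i - k i *: 1); split=> //.
- exists i1; rewrite mulf_neq0 ?invr_eq0 ?coef1_0 //.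
  by rewrite coef_barMl mulf_neq0 ?tau_neq0 // sub0r opprK.
- move=> i a; rewrite -scaleNr addrC coef_linear.
  have [->|a0] := eqVneq a 0.
    by rewrite /k mulNr divfK ?coef1_0 // addNr eqxx.
  have -> : coef 1 a = 0.
    apply: contraNeq a0 => h; have := @inFS1 (fun a => a == 0) (eqxx _).
    by move/(_ _ h).
  rewrite mulr0 add0r coef_barMl mulf_eq0 negb_or => /andP[_ ha].
  rewrite opprK in ha; have ab : inB a.
    by rewrite -[a](addrK b); apply: inBD (fB _ _ ha) (inBN hb).
  split=> //; rewrite lt_neqAle; apply/andP; split.
    by apply: contraNneq a0 => /(phi_inj ab) ->.
  by have := bmax _ (sP _ _ ha); rewrite phiD ger_pMl.
- by move=> i; rewrite addrC subrK.
Qed.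

(** Leading term [1]. These elements form a multiplicative set, and every nonzero element of F*B
    becomes one of them after multiplication by a unit. *)
Definition monic y := inFS neg (y - 1).

Lemma monic_nonpos y : monic y -> inFS nonpos y.
Proof.
move=> h; rewrite -[y](subrK 1); apply: inFSD; last exact: inFS1 nonpos0.
exact: inFS_sub neg_nonpos h.
Qed.

Lemma monic_inFB y : monic y -> inFB y.
Proof. by move/monic_nonpos; apply: inFS_sub => a []. Qed.

Lemma monicM y z : monic y -> monic z -> monic (y * z).
Proof.
move=> hy hz; rewrite /monic.
have -> : y * z - 1 = (y - 1) * z + (z - 1) by rewrite mulrBl mul1r addrA subrK.
apply: inFSD => //; apply: inFSM hy (monic_nonpos hz) => a b ha hb.
by rewrite addrC; apply: nonpos_neg.
Qed.

Lemma monic1 : monic 1.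
Proof. by rewrite /monic subrr; case: (inFS_subsp neg). Qed.

Lemma monic_neq0 y : monic y -> y != 0.
Proof.
move=> h; apply: contra_not_neq neg0 => y0; apply: (h 0).
by rewrite y0 sub0r -scaleN1r coefZ mulf_neq0 ?coef1_0 // oppr_eq0 oner_eq0.
Qed.

Lemma monic_swap a y : monic y -> exists2 z, monic z & bar a * y = z * bar a.
Proof.
move=> /(bar_swap a) [z [hz e _]]; exists (1 + z); first by rewrite /monic addrC addKr.
by rewrite mulrDl mul1r -e mulrBr mulr1 addrC subrK.
Qed.

Lemma monic_swapV a y : monic y -> exists2 z, monic z & y * bar a = bar a * z.
Proof.
move=> /(bar_swapV a) [z [hz e _]]; exists (1 + z); first by rewrite /monic addrC addKr.
by rewrite mulrDr mulr1 -e mulrBl mul1r addrC subrK.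
Qed.

Lemma monic_normal y : inFB y -> y != 0 ->
  exists b (k : F), [/\ inB b, k != 0 & monic (k *: (bar (- b) * y))].
Proof.
move=> By y0.
have [||b [k [m [hb [i ki] mneg e]]]] := @leading_term 1 (fun=> y).
- by [].
- by exists ord0.
exists b, (k i)^-1; split; rewrite ?invr_eq0 //.
rewrite /monic (e i) scalerDr scalerA mulVf // scale1r addrC addKr.
exact: inFSZ.
Qed.

(** After normalising both factors and moving the translation past the first, the product is monic
    up to a unit. *)
Lemma inFB_domain y z : inFB y -> inFB z -> y != 0 -> z != 0 -> y * z != 0.
Proof.
move=> By Bz y0 z0.
have [b [k [_ _ my]]] := monic_normal By y0.
have [b' [k' [_ _ mz]]] := monic_normal Bz z0.
have [w mw e] := monic_swap (- b') my.
apply: contraTneq isT => yz0; have := monic_neq0 (monicM mw mz).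
rewrite -scalerAr mulrA -e -!scalerAr -!scalerAl -!mulrA yz0.
by rewrite !mulr0 !scaler0 eqxx.
Qed.

Lemma inFBM y z : inFB y -> inFB z -> inFB (y * z).
Proof. by apply: inFSM => a b; exact: inBD. Qed.

Hypothesis r_le_n : (r <= n)%N.

Definition boxvec (k : nat) (g : {ffun 'I_r -> 'I_k}) : A :=
  \row_i (if insub (val i) is Some j then (g j : nat)%:Z else 0).

Lemma boxvecE k (g : {ffun 'I_r -> 'I_k}) (j : 'I_r) :
  boxvec g 0 (widen_ord r_le_n j) = (g j : nat).
Proof. by rewrite mxE /= valK. Qed.

Lemma boxvec_inB k (g : {ffun 'I_r -> 'I_k}) : inB (boxvec g).
Proof. by move=> i ri; rewrite mxE insubF // ltnNge ri. Qed.

Lemma boxvec_inj k : injective (@boxvec k).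
Proof.
move=> g h e; apply/ffunP => j; apply: val_inj => /=.
by have := boxvecE g j; rewrite e boxvecE => -[].
Qed.

(** Translating the box with coordinates in [[0, k)] by [a] stays within [[-c, k + c]]; subtracting
    the corner vector with all coordinates [c] encodes the latter by a box starting at [0]. *)
Lemma inB_boxvec (c k : nat) a (g : {ffun 'I_r -> 'I_k}) : inB a ->
  (forall i, absz (a 0%R i) <= c)%N ->
  exists u : {ffun 'I_r -> 'I_(k + (c + c)).+1},
    boxvec g + a = boxvec u - boxvec [ffun=> @ord_max c].
Proof.
move=> aB ac.
exists [ffun j : 'I_r => inord (absz ((g j : nat)%:Z + a 0 (widen_ord r_le_n j) + c%:Z))].
apply/rowP => i; rewrite !mxE; case: insubP => [j jr ji|].
  rewrite !ffunE; have -> : widen_ord r_le_n j = i by apply: val_inj.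
  have := ac i; have := ltn_ord (g j).
  move: (a 0 i) (nat_of_ord (g j)) => x y yk xc.
  by rewrite inordK /=; lia.
by rewrite -leqNgt => ri; rewrite aB // subr0 addr0.
Qed.

Lemma supp_bounded (I J : finType) (f : I -> J -> FA) : exists c : nat,
  forall i j a, coef (f i j) a != 0 -> forall l, (absz (a 0%R l) <= c)%N.
Proof.
pose m a := (\max_l absz (a 0%R l))%N.
exists (\max_i \max_j \max_(a <- supp (f i j)) m a)%N => i j a ha l.
have as_ : a \in supp (f i j) by apply: contraNT ha => /coef_out ->.
have l1 : (absz (a 0%R l) <= m a)%N by exact: (leq_bigmax l).
have l2 := @leq_bigmax_seq _ (supp (f i j)) xpredT m a as_ isT.
have l3 := @leq_bigmax _ (fun j => \max_(a <- supp (f i j)) m a)%N j.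
have l4 := @leq_bigmax _ (fun i => \max_j \max_(a <- supp (f i j)) m a)%N i.
by apply: leq_trans l4; apply: leq_trans l3; apply: leq_trans l2.
Qed.

(** Unknowns supported in a box of side [k] give [N k^r] scalars, subject to [q (k + 2c + 1)^r]
    scalar equations, where [c] bounds the supports of the coefficients. For the [k] of [box_growth]
    there are more unknowns than equations. *)
Lemma inFB_wide_system (q N : nat) (f : 'I_N -> 'I_q -> FA) : (q < N)%N ->
  (forall i j, inFB (f i j)) ->
  exists h : 'I_N -> FA, [/\ forall i, inFB (h i), exists i, h i != 0
    & forall j, \sum_i h i * f i j = 0].
Proof.
move=> qN fB; have [c fc] := supp_bounded f.
have [k kq] := box_growth q r (c + c).+1.
pose cv : A := boxvec [ffun=> @ord_max c].
pose T1 : finType := ('I_N * {ffun 'I_r -> 'I_k})%type.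
pose T2 : finType := ('I_q * {ffun 'I_r -> 'I_(k + (c + c)).+1})%type.
have [|x [[i0 g0] /= x0] xs] := @wide_system F T1 T2
  (fun t w => coef (bar (boxvec t.2) * f t.1 w.1) (boxvec w.2 - cv)).
  rewrite !card_prod !card_ffun !card_ord -addnS; apply: leq_trans kq _.
  by rewrite leq_mul2r qN orbT.
exists (fun i => \sum_g x (i, g) *: bar (boxvec g)); split.
- move=> i; apply: subsp_sum; first exact: inFS_subsp.
  by move=> g _; apply: inFSZ; apply: inFS_bar; exact: boxvec_inB.
- exists i0; apply/eqP => /(congr1 (fun y => coef y (boxvec g0))).
  rewrite coef0 coef_sum (bigD1 g0) //= big1 => [|g gn].
    by rewrite coefZ coef_bar eqxx mulr1 addr0; apply/eqP.
  by rewrite coefZ coef_bar (inj_eq (@boxvec_inj k)) eq_sym (negPf gn) mulr0.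
move=> j; apply: coef_inj => a; rewrite coef0.
have -> : coef (\sum_i (\sum_g x (i, g) *: bar (boxvec g)) * f i j) a =
   \sum_(t : T1) x t * coef (bar (boxvec t.2) * f t.1 j) a.
  rewrite coef_sum; under eq_bigr do rewrite mulr_suml coef_sum.
  rewrite pair_big /=; apply: eq_bigr => -[i g] _ /=.
  by rewrite -scalerAl coefZ.
have [[[i g] h]|nh] := pselect (exists t : T1, coef (bar (boxvec t.2) * f t.1 j) a != 0).
  move: h; rewrite /= coef_barMl mulf_eq0 negb_or => /andP[_ ha].
  have [u] := inB_boxvec g (fB _ _ _ ha) (fc _ _ _ ha).
  by rewrite addrC subrK => ->; apply: (xs (j, u)).
by rewrite big1 // => t _; apply/eqP; apply: contraPT nh => h /=; case; exists t;
  apply: contraNneq h => ->; rewrite mulr0.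
Qed.

(** One equation in two unknowns; [h] cannot vanish, since then [g * z = 0] with [g] and [z] nonzero
    in a domain. *)
Lemma inFB_ore y z : inFB y -> inFB z -> z != 0 ->
  exists h g, [/\ inFB h, inFB g, h != 0 & h * y = g * z].
Proof.
move=> By Bz z0.
have [//||h [hB [i hi] /(_ ord0)]] :=
  @inFB_wide_system 1 2 (fun i _ => if i == ord0 then y else z).
  by move=> i _; case: ifP.
rewrite big_ord_recl big_ord1 /= => e.
have e' : h ord0 * y = - h (lift ord0 ord0) * z.
  by apply/eqP; rewrite mulNr -addr_eq0 e.
exists (h ord0), (- h (lift ord0 ord0)); split=> //.
  exact: (subspN (@inFS_subsp inB)).
apply/eqP => h0; move/eqP: e'; rewrite h0 mul0r mulNr eq_sym oppr_eq0; apply/negP.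
apply: inFB_domain => //; case: (unliftP ord0 i) hi => [j|] ->; last by rewrite h0 eqxx.
by rewrite ord1.
Qed.

(* The translate [bar a * L]. *)
Definition tr a L y := L (bar (- a) * y).

Definition FBmod (Y : FA -> Prop) :=
  subsp Y /\ forall b y, inB b -> Y y -> Y (bar b * y).

Definition tor (Y : FA -> Prop) u := exists z, [/\ inFB z, z != 0 & Y (z * u)].

Lemma FBmodM Y z y : FBmod Y -> inFB z -> Y y -> Y (z * y).
Proof.
move=> [sY hY] Bz Yy; apply: (@inFS_ind _ (fun z => Y (z * y))) Bz.
  exact: subsp_mulr.
by move=> b hb; apply: hY.
Qed.

(** The Ore condition provides a common left multiple of the two multipliers, which works for the
    sum. *)
Lemma FBmod_tor Y : FBmod Y -> FBmod (tor Y).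
Proof.
move=> mY; have [sY hY] := mY; split; [split|].
- by exists 1; rewrite oner_neq0 mulr0; split=> //; [exact: inFS1 inB0|case: sY].
- move=> k u v [z [Bz z0 zu]] [w [Bw w0 wv]].
  have [h [g [Bh Bg h0 e]]] := inFB_ore Bz Bw w0.
  exists (h * z); split; [exact: inFBM|exact: inFB_domain|].
  rewrite mulrDr -scalerAr; apply: subspD => //.
    by apply: subspZ => //; rewrite -mulrA; apply: FBmodM.
  by rewrite e -mulrA; apply: FBmodM.
- move=> b u hb [z [Bz z0 zu]]; have [w [Bw e w0]] := bar_swap b Bz.
  by exists w; rewrite w0; split=> //; rewrite mulrA -e -mulrA; apply: hY.
Qed.

Lemma tor_bar Y Z a u : (forall y, Y y -> Z (bar a * y)) ->
  tor Y u -> tor Z (bar a * u).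
Proof.
move=> h [z [Bz z0 zu]]; have [w [Bw e w0]] := bar_swap a Bz.
by exists w; rewrite w0; split=> //; rewrite mulrA -e -mulrA; apply: h.
Qed.

Lemma tor_tor Y u : tor (tor Y) u -> tor Y u.
Proof.
move=> [z [Bz z0 [w [Bw w0 h]]]]; exists (w * z).
by split; [exact: inFBM|exact: inFB_domain|rewrite -mulrA].
Qed.

Lemma tor_sub Y u : Y u -> tor Y u.
Proof. by exists 1; rewrite oner_neq0 mul1r; split=> //; exact: inFS1 inB0. Qed.

Lemma tor_mono (Y Z : FA -> Prop) u : (forall y, Y y -> Z y) -> tor Y u -> tor Z u.
Proof. by move=> h [z [Bz z0 zu]]; exists z; split=> //; apply: h. Qed.

(** * The module [F*A / I] and its [F*B]-rank *)

Definition lideal (I : FA -> Prop) :=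
  subsp I /\ forall u y, I y -> I (u * y).

Variable I : FA -> Prop.
Hypothesis Ileft : lideal I.
Hypothesis IB : forall y, inFB y -> I y -> y = 0.

Lemma I_subsp : subsp I. Proof. by case: Ileft. Qed.

Lemma I_mul u y : I y -> I (u * y). Proof. by case: Ileft => _; apply. Qed.

Definition J Q y := exists2 z, inFS Q z & I (y - z).

Lemma J_subsp Q : subsp (J Q).
Proof.
have sI := I_subsp; split.
  by exists 0; [case: (inFS_subsp Q)|rewrite subr0; case: sI].
move=> k y z [y' Qy Iy] [z' Qz Iz]; exists (k *: y' + z').
  by case: (inFS_subsp Q) => _; apply.
rewrite opprD addrACA -scalerBr; case: sI => _; exact.
Qed.

Lemma J_I Q y : I y -> J Q y.
Proof. by exists 0; [case: (inFS_subsp Q)|rewrite subr0]. Qed.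

Lemma J_bar Q a : Q a -> J Q (bar a).
Proof. by exists (bar a); [exact: inFS_bar|rewrite subrr; case: I_subsp]. Qed.

Lemma J_ind Q K y : subsp K -> (forall u, I u -> K u) ->
  (forall a, Q a -> K (bar a)) -> J Q y -> K y.
Proof.
move=> sK IK QK [z Qz Iyz]; rewrite -[y](subrK z).
by apply: subspD => //; [exact: IK|exact: inFS_ind Qz].
Qed.

Lemma J_bind Q P y : (forall a, Q a -> J P (bar a)) -> J Q y -> J P y.
Proof. by apply: J_ind; [exact: J_subsp|exact: J_I]. Qed.

Lemma J_mono Q P y : (forall a, Q a -> P a) -> J Q y -> J P y.
Proof. by move=> h; apply: J_bind => a /h; exact: J_bar. Qed.

Lemma J_mulbar Q P b y : (forall a, Q a -> P (b + a)) -> J Q y -> J P (bar b * y).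
Proof.
move=> h [z Qz Iyz]; exists (bar b * z); last by rewrite -mulrBr; exact: I_mul.
exact: inFS_mulbar Qz.
Qed.

Lemma J_barD Q P a b : (forall c, Q c -> P (b + c)) -> J Q (bar a) -> J P (bar (a + b)).
Proof.
move=> h /(J_mulbar h); rewrite barM addrC.
exact: (subspZV (@J_subsp P) (tau_neq0 _ _)).
Qed.

(** Finite witnesses make [J] compatible with unions of chains of index sets. *)
Lemma J_finite Q y : J Q y ->
  exists2 s : seq A, forall a, a \in s -> Q a & J (fun a => a \in s) y.
Proof.
move=> [z Qz Iyz]; exists [seq a <- supp z | coef z a != 0].
  by move=> a; rewrite mem_filter => /andP[/Qz].
exists z => // a ha; rewrite mem_filter ha /=.
by apply: contraNT ha => /coef_out ->.
Qed.

Lemma J_one Q : J Q 1 <-> J Q (bar 0).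
Proof.
rewrite bar0; split; first exact: (subspZ _ (@J_subsp Q)).
exact: (subspZV (@J_subsp Q) (tau_neq0 _ _)).
Qed.

(** A union of cosets of [B]: [J (FBset S)] is the F*B-submodule generated by [I] and the [bar s]
    with [s] in [S]. *)
Definition FBset (S : seq A) a := exists2 s, s \in S & inB (a - s).

Lemma FBmod_J Q : (forall a b, inB b -> Q a -> Q (b + a)) -> FBmod (J Q).
Proof.
move=> h; split; first exact: J_subsp.
by move=> b y hb; apply: J_mulbar => a; apply: h.
Qed.

Lemma FBmod_FBset S : FBmod (J (FBset S)).
Proof.
apply: FBmod_J => a b hb [s sS hs]; exists s => //.
by rewrite -addrA; apply: inBD.
Qed.

Lemma J_FBset S y : J (FBset S) y -> exists2 g : 'I_(size S) -> FA,
  forall j, inFB (g j) & I (y - \sum_j g j * bar S`_j).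
Proof.
have sB := @inFS_subsp inB.
apply: (@J_ind _ (fun y => exists2 g : 'I_(size S) -> FA,
  forall j, inFB (g j) & I (y - \sum_j g j * bar S`_j))) => [|u Iu|a [s sS hs]].
- split.
    exists (fun=> 0); first by move=> _; case: sB.
    by rewrite big1 ?subr0 => [|i _]; rewrite ?mul0r //; case: I_subsp.
  move=> k u v [g gB gI] [h hB hI]; exists (fun j => k *: g j + h j).
    by move=> j; case: sB => _; apply.
  under eq_bigr do rewrite mulrDl -scalerAl.
  rewrite big_split -scaler_sumr opprD addrACA -scalerBr.
  by case: I_subsp => _; apply.
- exists (fun=> 0); first by move=> _; case: sB.
  by rewrite big1 ?subr0 // => i _; rewrite mul0r.
- have iS : (index s S < size S)%N by rewrite index_mem.
  pose i := Ordinal iS.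
  exists (fun j => if j == i then (tau (a - s) s)^-1 *: bar (a - s) else 0).
    by move=> j; case: ifP => _; [apply: inFSZ; apply: inFS_bar|case: sB].
  rewrite (bigD1 i) //= eqxx big1 => [|j /negPf ->]; last by rewrite mul0r.
  rewrite nth_index // -scalerAl barM scalerA mulVf ?tau_neq0 // scale1r subrK.
  by rewrite addr0 subrr; case: I_subsp.
Qed.

Definition FBfree (N : nat) (t : 'I_N -> FA) :=
  forall h : 'I_N -> FA, (forall i, inFB (h i)) -> I (\sum_i h i * t i) ->
  forall i, h i = 0.

Definition spanning (S : seq A) := forall u, tor (J (FBset S)) u.

(** Multiples [z i * t i] are F*B-combinations of [S] modulo [I]. If [N] exceeded the size of [S],
    these would satisfy a nontrivial relation, which is one between the [t i] because F*B is a
    domain. *)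
Lemma spanning_rank S (N : nat) (t : 'I_N -> FA) :
  spanning S -> FBfree t -> (N <= size S)%N.
Proof.
move=> sS ft; rewrite leqNgt; apply/negP => SN.
have /choice[z zP] i : exists z, [/\ inFB z, z != 0 & J (FBset S) (z * t i)] by exact: sS.
have /choice[g gP] i : exists g : 'I_(size S) -> FA, (forall j, inFB (g j)) /\
    I (z i * t i - \sum_j g j * bar S`_j).
  by have [_ _ /J_FBset[g gB gI]] := zP i; exists g.
have [|h [hB [i hi] h0]] := @inFB_wide_system _ _ g SN.
  by move=> i j; case: (gP i).
case/negP: (hi); apply/eqP; have [zB z0 _] := zP i.
have : h i * z i = 0.
  apply: (ft (fun i => h i * z i)) => [j|].
    by apply: inFBM => //; case: (zP j).
  have -> : \sum_i h i * z i * t i =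
      \sum_i h i * (z i * t i - \sum_j g i j * bar S`_j).
    under [RHS]eq_bigr do rewrite mulrBr mulr_sumr mulrA.
    rewrite sumrB [X in _ - X]exchange_big /= [X in _ - X]big1 ?subr0 // => j _.
    by under eq_bigr do rewrite mulrA; rewrite -mulr_suml h0 mul0r.
  apply: subsp_sum; first exact: I_subsp.
  by move=> j _; apply: I_mul; case: (gP j).
by move/eqP; apply: contraTeq => hn; exact: inFB_domain.
Qed.

(** * Word-metric balls: finite rank, or a free family of linear growth *)

Fixpoint ball (k : nat) : seq A :=
  if k is k'.+1 then ball k' ++ [seq s + xgen i | s <- ball k', i <- enum 'I_n]
                     ++ [seq s - xgen i | s <- ball k', i <- enum 'I_n]
  else [:: 0].

Lemma ball_sub k l : (k <= l)%N -> {subset ball k <= ball l}.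
Proof.
move=> /subnKC <-; elim: (l - k)%N => [|m IH] s sk; first by rewrite addn0.
by rewrite addnS /= mem_cat IH.
Qed.

Lemma ballD k s i : s \in ball k -> s + xgen i \in ball k.+1.
Proof.
move=> sk; rewrite /= !mem_cat; apply/orP; right; apply/orP; left.
by apply/allpairsP; exists (s, i); rewrite mem_enum.
Qed.

Lemma ballB k s i : s \in ball k -> s - xgen i \in ball k.+1.
Proof.
move=> sk; rewrite /= !mem_cat; apply/orP; right; apply/orP; right.
by apply/allpairsP; exists (s, i); rewrite mem_enum.
Qed.

Lemma ballDn k s i (m : nat) : s \in ball k -> s + xgen i *+ m \in ball (k + m).
Proof.
move=> sk; elim: m => [|m IH]; first by rewrite mulr0n addr0 addn0.
by rewrite mulrSr addrA addnS; apply: ballD.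
Qed.

Lemma ball_boxvec k j (g : {ffun 'I_r -> 'I_k}) s : s \in ball j ->
  boxvec g + s \in ball (j + r * k).
Proof.
move=> sj.
have -> : boxvec g = \sum_(i : 'I_r) xgen (widen_ord r_le_n i) *+ g i.
  apply/rowP => l; rewrite mxE summxE; case: insubP => [i ir il|].
    have <- : widen_ord r_le_n i = l by apply: val_inj.
    rewrite (bigD1 i) //= big1 => [|i' i'n].
      rewrite mulmxnE mxE !eqxx /= addr0; exact: esym (natz _).
    rewrite mulmxnE mxE /=; case: eqP => [/(congr1 val) /= e|]; last by rewrite mul0rn.
    by case/eqP: i'n; apply: val_inj.
  rewrite -leqNgt => rl; rewrite big1 // => i _; rewrite mulmxnE mxE /=.
  case: eqP => [/(congr1 val) /= e|]; last by rewrite mul0rn.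
  by move: (leq_trans (ltn_ord i) rl); rewrite -e /= ltnn.
have h (l : seq 'I_r) : \sum_(i <- l) xgen (widen_ord r_le_n i) *+ g i + s
    \in ball (j + \sum_(i <- l) g i).
  elim: l => [|i l IH]; first by rewrite !big_nil add0r addn0.
  rewrite !big_cons -addrA addrC addnCA addnC.
  by apply: ballDn.
apply: ball_sub (h (index_enum _)); rewrite leq_add2l.
rewrite -[X in (X * _)%N](card_ord r) -sum_nat_const; apply: leq_sum => i _.
exact: ltnW.
Qed.

Lemma A_ind (G : A -> Prop) : G 0 -> (forall a i, G a -> G (a + xgen i)) ->
  (forall a i, G a -> G (a - xgen i)) -> forall a, G a.
Proof.
move=> G0 GD GB a; rewrite [a]row_sum_delta.
elim: (index_enum _) => [|i s IH]; first by rewrite big_nil.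
rewrite big_cons addrC -[a 0 i]intz scaler_int.
move: (\sum_(j <- s) _) IH => t Gt.
elim/int_rect: (a 0 i) => [|m IHm|m IHm].
- by rewrite mulr0z addr0.
- by rewrite -[m.+1]addn1 PoszD mulrzDr addrA; apply: GD.
- by rewrite -[m.+1]addn1 PoszD opprD mulrzDr addrA; apply: GB.
Qed.

(** If [ball k.+1] adds only torsion, the torsion closure of the span of [ball k] is stable under
    all generators and their inverses, hence is everything. *)
Lemma ball_spanning k :
  (forall a, a \in ball k.+1 -> tor (J (FBset (ball k))) (bar a)) ->
  spanning (ball k).
Proof.
move=> hk; set Y := J (FBset (ball k)) in hk *.
have mY : FBmod Y by exact: FBmod_FBset.
have [sT mT] := FBmod_tor mY.
have Y1 u : J (FBset (ball k.+1)) u -> tor Y u.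
  apply: J_ind => // [v Iv|a [s sk hs]]; first exact/tor_sub/J_I.
  apply: (subspZV sT (tau_neq0 (a - s) s)).
  by rewrite -[in bar a](subrK s a) -barM; apply: mT => //; apply: hk.
have step a u : (forall s, s \in ball k -> s + a \in ball k.+1) ->
    tor Y u -> tor Y (bar a * u).
  move=> ha hu; apply: tor_tor; apply: (tor_mono Y1).
  apply: tor_bar hu => y; apply: J_mulbar => c [s sk hs].
  by exists (s + a); [exact: ha|rewrite [s + a]addrC opprD addrACA subrr add0r].
have all a : tor Y (bar a).
  elim/A_ind: a => [|a i h|a i h].
  - by apply: hk; apply: (@ball_sub 0); rewrite ?inE.
  - rewrite addrC; apply: (subspZV sT (tau_neq0 (xgen i) a)); rewrite -barM.
    by apply: step => // s; apply: ballD.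
  - rewrite addrC; apply: (subspZV sT (tau_neq0 (- xgen i) a)); rewrite -barM.
    by apply: step => // s; apply: ballB.
move=> u; apply: (@inFS_ind (fun=> True)) => //.
Qed.

(** Unless the rank stabilises at some ball, each ball contains an element that is not torsion
    modulo the previous one. *)
Lemma spanning_or_free : (exists S, spanning S) \/
  exists s : nat -> A, (forall k, s k \in ball k) /\
    forall k, FBfree (fun i : 'I_k => bar (s i)).
Proof.
have [[k /ball_spanning ?]|nk] := pselect (exists k, forall a, a \in ball k.+1 ->
    tor (J (FBset (ball k))) (bar a)); first by left; exists (ball k).
right; have /choice[s sP] k : exists a, a \in ball k.+1 /\
    ~ tor (J (FBset (ball k))) (bar a).
  apply: contrapT => h; apply: nk; exists k => a ak; apply: contrapT => ha.
  by apply: h; exists a.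
(* The element [s k], found in [ball k.+1], is put at position [k.+1], after the starting point
   [0]. *)
pose s' k := if k is k'.+1 then s k' else 0.
have s'P k : s' k \in ball k by case: k => [|k] /=; rewrite ?inE //; case: (sP k).
exists s'; split=> // k; elim: k => [|k IH] h hB hI; first by case.
(* Otherwise the last element would be torsion modulo the preceding ball; for a family of one
   element the contradiction comes from [IB]. *)
have hk : h ord_max = 0.
  apply/eqP/negPn/negP => h0; case: k {IH} => [|k] in h hB hI h0 *.
    move: hI; rewrite big_ord1 => hI; have e : ord0 = ord_max :> 'I_1 by apply: val_inj.
    rewrite e in hI; have hb : inFB (h ord_max * bar 0).
      by apply: inFBM => //; apply: inFS_bar; exact: inB0.
    case/eqP: (inFB_domain (hB ord_max) (inFS_bar inB0) h0 (bar_neq0 0)).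
    exact: IB.
  case: (sP k) => _; apply; exists (h ord_max); split=> //.
  move: hI; rewrite big_ord_recr /=; set w := (X in X + _); set v := h _ * _ => hI.
  have -> : v = (w + v) - w by rewrite addrAC subrr add0r.
  apply: (subspB (@J_subsp _)); first exact: J_I.
  apply: subsp_sum; first exact: J_subsp.
  move=> i _; apply: (FBmodM (FBmod_FBset _)) => //; apply: J_bar.
  exists (s' i); last by rewrite subrr; exact: inB0.
  by apply: ball_sub (s'P i); rewrite -ltnS.
move=> i; case: (unliftP ord_max i) => [j|] -> //.
have -> : lift ord_max j = widen_ord (leqnSn k) j.
  by apply: val_inj; rewrite /= /bump leqNgt ltn_ord.
apply: (IH (fun j => h (widen_ord (leqnSn k) j))) => //.
by move: hI; rewrite big_ord_recr /= hk mul0r addr0.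
Qed.

(** A box of [k^r] translates of each of [k] free elements yields [k^(r+1)] monomials independent
    over [F] modulo [I]. *)
Lemma FBfree_box (s : nat -> A) (k : nat) (x : 'I_k * {ffun 'I_r -> 'I_k} -> F) :
  FBfree (fun i : 'I_k => bar (s i)) ->
  I (\sum_t x t *: bar (boxvec t.2 + s t.1)) -> forall t, x t = 0.
Proof.
move=> fs hI [i g].
pose h (i : 'I_k) := \sum_g (x (i, g) / tau (boxvec g) (s i)) *: bar (boxvec g).
have hB j : inFB (h j).
  apply: subsp_sum; first exact: inFS_subsp.
  by move=> g' _; apply: inFSZ; apply: inFS_bar; exact: boxvec_inB.
have /(fs h hB)/(_ i) : I (\sum_i h i * bar (s i)).
  suff <- : \sum_t x t *: bar (boxvec t.2 + s t.1) = \sum_i h i * bar (s i) by [].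
  under [RHS]eq_bigr do rewrite mulr_suml.
  rewrite pair_bigA /=; apply: eq_bigr => -[j g'] _ /=.
  by rewrite -scalerAl barM scalerA divfK ?tau_neq0.
move/(congr1 (fun y => coef y (boxvec g))); rewrite coef0 coef_sum (bigD1 g) //=.
rewrite big1 => [|g' g'n]; last first.
  by rewrite coefZ coef_bar (inj_eq (@boxvec_inj k)) eq_sym (negPf g'n) mulr0.
rewrite coefZ coef_bar eqxx mulr1 addr0 => /eqP.
by rewrite mulf_eq0 invr_eq0 (negPf (tau_neq0 _ _)) orbF => /eqP.
Qed.

(** * Lattices *)

Definition comb (N : nat) (c : 'rV[F]_N) (t : 'I_N -> FA) := \sum_i c 0 i *: t i.

Lemma comb_is_linear N (t : 'I_N -> FA) (k : F) (c d : 'rV[F]_N) :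
  comb (k *: c + d) t = k *: comb c t + comb d t.
Proof.
rewrite /comb scaler_sumr -big_split; apply: eq_bigr => i _ /=.
by rewrite !mxE scalerDl scalerA.
Qed.

Lemma comb0 N (t : 'I_N -> FA) : comb 0 t = 0.
Proof. by rewrite /comb big1 // => i _; rewrite mxE scale0r. Qed.

Lemma combZ N (t : 'I_N -> FA) (k : F) (c : 'rV[F]_N) : comb (k *: c) t = k *: comb c t.
Proof. by rewrite -[k *: c]addr0 comb_is_linear comb0 addr0. Qed.

Lemma comb_delta N (t : 'I_N -> FA) i : comb (delta_mx 0 i) t = t i.
Proof.
rewrite /comb (bigD1 i) //= mxE !eqxx scale1r big1 ?addr0 // => j /negPf jn.
by rewrite mxE jn andbF scale0r.
Qed.

Lemma comb_mulmx N p (z : 'rV[F]_p) (R : 'M[F]_(p, N)) (t : 'I_N -> FA) :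
  comb (z *m R) t = comb z (fun i => comb (row i R) t).
Proof.
rewrite /comb; under [RHS]eq_bigr do rewrite scaler_sumr.
rewrite exchange_big /=; apply: eq_bigr => j _; rewrite mxE scaler_suml.
by apply: eq_bigr => i _; rewrite scalerA mxE.
Qed.

Lemma eq_comb N (c : 'rV[F]_N) (t v : 'I_N -> FA) : t =1 v -> comb c t = comb c v.
Proof. by move=> e; apply: eq_bigr => i _; rewrite e. Qed.

Lemma combB N (c : 'rV[F]_N) (t v : 'I_N -> FA) :
  comb c (fun i => t i - v i) = comb c t - comb c v.
Proof. by rewrite /comb -sumrB; apply: eq_bigr => i _; rewrite scalerBr. Qed.

Lemma comb_subsp K N (c : 'rV[F]_N) (t : 'I_N -> FA) : subsp K ->
  (forall i, K (t i)) -> K (comb c t).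
Proof. by move=> sK h; apply: subsp_sum => // i _; apply: subspZ. Qed.

Hypothesis Imax : forall I' : FA -> Prop, lideal I' -> (forall y, I y -> I' y) ->
  (exists2 y, I' y & ~ I y) -> exists y, [/\ inFB y, y != 0 & I' y].
Hypothesis ex_neg : exists b, neg b.
Variable S1 : seq A.
Hypothesis spanS1 : spanning S1.

Section Lattices.
Variable P : A -> Prop.
Hypothesis P_nonpos : forall b, nonpos b -> P b.
Hypothesis PD : forall a b, P a -> P b -> P (a + b).

Definition lattice L :=
  [/\ subsp L, forall y, I y -> L y & forall p y, P p -> L y -> L (bar p * y)].

Definition mL L y := exists2 b, neg b & tr b L y.

Lemma subsp_barMD K a b y : subsp K -> K (bar a * (bar b * y)) <-> K (bar (a + b) * y).
Proof.
move=> sK; rewrite barMA; split; last exact: subspZ.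
by apply: subspZV => //; exact: tau_neq0.
Qed.

Lemma subsp_barMC K a b y : subsp K -> K (bar a * (bar b * y)) -> K (bar b * (bar a * y)).
Proof. by move=> sK /(subsp_barMD _ _ _ sK); rewrite addrC => /(subsp_barMD _ _ _ sK). Qed.

Lemma subsp_barNK K a y : subsp K -> K (bar (- a) * (bar a * y)) <-> K y.
Proof.
move=> sK; rewrite barNK; split; last exact: subspZ.
by apply: subspZV => //; exact: tauM_neq0.
Qed.

Lemma lattice_tr a L : lattice L -> lattice (tr a L).
Proof.
move=> [sL IL PL]; split; first exact: subsp_mull.
  by move=> y Iy; apply/IL/I_mul.
by move=> p y Pp Ly; apply: subsp_barMC => //; apply: PL.
Qed.

(** Translates of [L] by [B] form a chain, since [b1 - b2 <= 0] preserves [L]. Hence the union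
    [mL L] is a subspace. *)
Lemma tr_mono L b1 b2 y : lattice L -> inB b1 -> inB b2 -> phi b1 <= phi b2 ->
  tr b1 L y -> tr b2 L y.
Proof.
move=> [sL IL PL] h1 h2 le Ly.
have np : nonpos (b1 - b2).
  split; first by apply: inBD => //; exact: inBN.
  by rewrite phiD phiN ler_pdivrMr ?mul1r.
have := PL _ _ (P_nonpos np) Ly; move/(subsp_barMD _ _ _ sL).
by rewrite addrAC subrr add0r.
Qed.

Lemma neg_max b1 b2 : neg b1 -> neg b2 ->
  exists b, [/\ neg b, phi b1 <= phi b & phi b2 <= phi b].
Proof.
by move=> n1 n2; have [le|le] := leP (phi b1) (phi b2); [exists b2|exists b1];
  split=> //; exact: ltW.
Qed.

Lemma mL_subsp L : lattice L -> subsp (mL L).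
Proof.
move=> lL; have [[sL0 sL] IL PL] := lL; have [b bneg] := ex_neg; split.
  by exists b => //; rewrite /tr mulr0.
move=> k y z [b1 n1 h1] [b2 n2 h2]; have [b3 [n3 l1 l2]] := neg_max n1 n2.
exists b3 => //; rewrite /tr mulrDr -scalerAr; apply: sL.
  by apply: tr_mono h1; case: n1 n3 => ? _ [].
by apply: tr_mono h2; case: n2 n3 => ? _ [].
Qed.

Lemma mL_I L y : lattice L -> I y -> mL L y.
Proof. by move=> [sL IL PL] Iy; have [b bneg] := ex_neg; exists b => //; apply/IL/I_mul. Qed.

Lemma mL_bar L b y : lattice L -> neg b -> L y -> mL L (bar b * y).
Proof. by move=> [sL _ _] nb Ly; exists b => //; apply/subsp_barNK. Qed.

Lemma mL_neg L u y : lattice L -> inFS neg u -> L y -> mL L (u * y).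
Proof.
move=> lL hu Ly; apply: (@inFS_ind neg (fun u => mL L (u * y))) hu.
  exact/subsp_mulr/mL_subsp.
by move=> b nb; apply: mL_bar.
Qed.

Lemma lattice_nonpos L u y : lattice L -> inFS nonpos u -> L y -> L (u * y).
Proof.
move=> [sL _ PL] hu Ly; apply: (@inFS_ind nonpos (fun u => L (u * y))) hu.
  exact: subsp_mulr.
by move=> b /P_nonpos; move/PL; apply.
Qed.

Lemma mL_in L b y : lattice L -> neg b -> tr b L y -> L y.
Proof.
move=> [sL _ PL] /neg_nonpos/P_nonpos nb /(PL _ _ nb); rewrite barKN.
by apply: subspZV => //; exact: tauM_neq0.
Qed.

(* [rk L N] says that [L / mL L] has dimension at least [N]. *)
Definition rk L N := exists t : 'I_N -> FA,
  (forall i, L (t i)) /\ forall c : 'rV[F]_N, mL L (comb c t) -> c = 0.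

(** A family independent modulo [mL L] is F*B-free modulo [I]: dividing a relation by its leading
    term leaves a nontrivial relation over [F] modulo [mL L]. *)
Lemma rk_bound L N : lattice L -> rk L N -> (N <= size S1)%N.
Proof.
move=> lL [t [Lt ft]]; have [sL IL PL] := lL.
apply: (spanning_rank spanS1) (_ : FBfree t) => h hB hI i.
apply/eqP/negPn/negP => hi.
have [|b [k [m [hb [j kj] mneg e]]]] := leading_term hB; first by exists i.
suff /ft/rowP/(_ j) : mL L (comb (\row_i k i) t).
  by rewrite !mxE => k0; case/eqP: kj.
have -> : comb (\row_i k i) t = bar (- b) * (\sum_i h i * t i) - \sum_i m i * t i.
  rewrite mulr_sumr; apply/eqP; rewrite eq_sym subr_eq; apply/eqP.
  rewrite /comb -big_split; apply: eq_bigr => l _ /=.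
  by rewrite mulrA e mulrDl -scalerAl mul1r mxE.
apply: (subspB (mL_subsp lL)); first by apply: mL_I => //; apply: I_mul.
by apply: subsp_sum => [|l _]; [exact: mL_subsp|exact: mL_neg].
Qed.

Lemma rk_tr a L N : lattice L -> rk L N -> rk (tr a L) N.
Proof.
move=> lL [t [Lt ft]]; have [sL IL PL] := lL.
exists (fun i => bar a * t i); split=> [i|c]; first exact/subsp_barNK.
have -> : comb c (fun i => bar a * t i) = bar a * comb c t.
  by rewrite /comb mulr_sumr; apply: eq_bigr => i _; rewrite scalerAr.
case=> b nb h; apply: ft; exists b => //.
have := subsp_barMC (subsp_mull (bar (- a)) sL) h.
by move/(subsp_barNK _ _ sL).
Qed.

Definition sumL L1 L2 y := exists y1 y2, [/\ L1 y1, L2 y2 & y = y1 + y2].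
Definition capL L1 L2 y := L1 y /\ L2 y.

Lemma lattice_sum L1 L2 : lattice L1 -> lattice L2 -> lattice (sumL L1 L2).
Proof.
move=> [[z1 s1] I1 P1] [[z2 s2] I2 P2]; split; [split| |].
- by exists 0, 0; rewrite addr0.
- move=> k y z [y1 [y2 [h1 h2 ->]]] [z1' [z2' [h1' h2' ->]]].
  exists (k *: y1 + z1'), (k *: y2 + z2'); split; [exact: s1|exact: s2|].
  by rewrite scalerDr addrACA.
- by move=> y Iy; exists y, 0; rewrite addr0; split=> //; apply: I1.
- move=> p y Pp [y1 [y2 [h1 h2 ->]]]; exists (bar p * y1), (bar p * y2).
  by rewrite mulrDr; split=> //; [exact: P1|exact: P2].
Qed.

Lemma lattice_cap L1 L2 : lattice L1 -> lattice L2 -> lattice (capL L1 L2).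
Proof.
move=> [[z1 s1] I1 P1] [[z2 s2] I2 P2]; split; [split| |].
- by [].
- by move=> k y z [h1 h2] [h1' h2']; split; [exact: s1|exact: s2].
- by move=> y Iy; split; [exact: I1|exact: I2].
- by move=> p y Pp [h1 h2]; split; [exact: P1|exact: P2].
Qed.

Lemma sumLl L1 L2 y : lattice L2 -> L1 y -> sumL L1 L2 y.
Proof. by move=> [[z _] _ _] h; exists y, 0; rewrite addr0. Qed.

Lemma sumLr L1 L2 y : lattice L1 -> L2 y -> sumL L1 L2 y.
Proof. by move=> [[z _] _ _] h; exists 0, y; rewrite add0r. Qed.

Lemma mL_sum L1 L2 y : lattice L1 -> lattice L2 -> mL (sumL L1 L2) y ->
  exists y1 y2, [/\ mL L1 y1, mL L2 y2 & y = y1 + y2].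
Proof.
move=> l1 l2 [b nb [y1 [y2 [h1 h2 e]]]].
pose k := (tau b (- b) * tau 0 0)^-1.
exists (k *: (bar b * y1)), (k *: (bar b * y2)); split.
- by apply: (subspZ _ (mL_subsp l1)); apply: mL_bar.
- by apply: (subspZ _ (mL_subsp l2)); apply: mL_bar.
- by rewrite -scalerDr -mulrDr -e barKN scalerA mulVf ?tauM_neq0 ?scale1r.
Qed.

Lemma mL_mono (L1 L2 : FA -> Prop) y : (forall u, L1 u -> L2 u) -> mL L1 y -> mL L2 y.
Proof. by move=> h [b nb Ly]; exists b => //; apply: h. Qed.

(* As [m (L1 :&: L2) = m L1 :&: m L2], the dimension of [L / m L] is a modular
   function of [L]; hence lattices of maximal dimension are closed under sums. *)
Lemma rk_sum (e : nat) L1 L2 :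
  (forall L N, lattice L -> rk L N -> (N <= e)%N) ->
  lattice L1 -> lattice L2 -> rk L1 e -> rk L2 e -> rk (sumL L1 L2) e.
Proof.
move=> emax l1 l2 [t1 [Lt1 ft1]] [t2 [Lt2 ft2]].
have ls := lattice_sum l1 l2; have lc := lattice_cap l1 l2.
have sm1 := mL_subsp l1; have sm2 := mL_subsp l2.
pose t (i : 'I_(e + e)) := match split i with inl j => t1 j | inr j => t2 j end.
have combt (c : 'rV_(e + e)) : comb c t = comb (lsubmx c) t1 + comb (rsubmx c) t2.
  rewrite /comb big_split_ord; congr (_ + _); apply: eq_bigr => i _; rewrite mxE /t.
    by rewrite (unsplitK (inl i)).
  by rewrite (unsplitK (inr i)).
(* The row space of [B] consists of the linear relations modulo [mL (sumL L1 L2)] among the [2e]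
   vectors [t1], [t2]. *)
have [|k u v hu hv|B BP] := @subspace_rowspace _ _
  (fun v : 'rV[F]_(e + e) => mL (sumL L1 L2) (comb v t)).
- by rewrite comb0; case: (mL_subsp ls).
- by rewrite comb_is_linear; case: (mL_subsp ls) => _; apply.
(* A relation equals [w1 + w2] with each [wi] in [mL Li]; moving [w1] and the [t2] part across gives
   an element of the intersection. Those from a basis of relations are independent modulo [mL] of
   the intersection. *)
have rB : (\rank B <= e)%N.
  apply: (emax _ _ lc); pose R := row_base B.
  have Rrow i : mL (sumL L1 L2) (comb (row i R) t).
    by apply/BP; rewrite (submx_trans (row_sub i R)) // eq_row_base.
  have /choice[w wP] i : exists w, mL L1 w /\ mL L2 (comb (row i R) t - w).
    have [w1 [w2 [h1 h2 ->]]] := mL_sum l1 l2 (Rrow i); exists w1.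
    by rewrite addrAC subrr add0r.
  exists (fun i => comb (lsubmx (row i R)) t1 - w i); split=> [i|z hz].
    have [h1 h2] := wP i; split.
      case: (l1) => sL1 _ _; apply: subspB => //; first exact: comb_subsp.
      by case: h1 => b nb; apply: mL_in.
    have -> : comb (lsubmx (row i R)) t1 - w i =
       comb (row i R) t - w i - comb (rsubmx (row i R)) t2.
      by rewrite combt [RHS]addrAC addrK.
    case: (l2) => sL2 _ _; apply: subspB => //; last exact: comb_subsp.
    by case: h2 => b nb; apply: mL_in.
  have zw : comb z (fun i => comb (lsubmx (row i R)) t1 - w i) =
     comb (z *m lsubmx R) t1 - comb z w.
    rewrite combB comb_mulmx; congr (_ - _); apply: eq_comb => i.
    by congr comb; apply/rowP => j; rewrite !mxE.
  have zw1 : mL L1 (comb z w) by apply: comb_subsp => // i; case: (wP i).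
  have zl : z *m lsubmx R = 0.
    apply: ft1; rewrite -[comb _ _](subrK (comb z w)) -zw.
    by apply: subspD => //; apply: mL_mono hz => u [].
  have zr : z *m rsubmx R = 0.
    apply: ft2; have -> : comb (z *m rsubmx R) t2 =
       comb z (fun i => comb (row i R) t - w i) -
       comb z (fun i => comb (lsubmx (row i R)) t1 - w i).
      rewrite comb_mulmx -combB; apply: eq_comb => i.
      rewrite combt opprB addrA subrK addrAC subrr add0r.
      by congr comb; apply/rowP => j; rewrite !mxE.
    apply: subspB => //; last by apply: mL_mono hz => u [].
    by apply: comb_subsp => // i; case: (wP i).
  apply/eqP; rewrite -(mulmx_free_eq0 _ (row_base_free B)) -/R.
  by rewrite -[R]hsubmxK mul_mx_row zl zr row_mx0.
(* A complement of the relations is independent in the sum, and its dimension [2e - \rank B] is at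
   least [e]. *)
have rk' : rk (sumL L1 L2) (\rank (B^C)%MS).
  exists (fun i => comb (row i (row_base (B^C)%MS)) t); split=> [i|z].
    rewrite combt; exists (comb (lsubmx (row i (row_base (B^C)%MS))) t1).
    exists (comb (rsubmx (row i (row_base (B^C)%MS))) t2).
    by case: (l1) (l2) => sL1 _ _ [sL2 _ _]; split=> //; apply: comb_subsp.
  rewrite -comb_mulmx => /BP zB; apply/eqP.
  rewrite -(mulmx_free_eq0 _ (row_base_free (B^C)%MS)) -submx0 -(capmx_compl B).
  by rewrite sub_capmx zB (submx_trans (submxMl _ _)) // eq_row_base.
suff <- : \rank (B^C)%MS = e by [].
apply/eqP; rewrite eqn_leq (emax _ _ ls) //= mxrank_compl.
by rewrite leq_subRL ?leq_add2r // (leq_trans rB) ?leq_addr.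
Qed.

Definition maxlattice e L :=
  [/\ lattice L, rk L e & forall L' N, lattice L' -> rk L' N -> (N <= e)%N].

Lemma maxlattice_ex L : lattice L -> rk L 1 ->
  exists e M, (0 < e)%N /\ maxlattice e M.
Proof.
move=> lL rL.
pose ok N := `[< exists2 M, lattice M & rk M N >].
have ok1 : ok 1%N by apply/asboolP; exists L.
have bd N : ok N -> (N <= size S1)%N.
  by case/asboolP => M lM; exact: rk_bound lM.
case: (ex_maxnP (ex_intro _ 1%N ok1) bd) => e /asboolP[M lM rM] emax.
exists e, M; split; first exact: emax.
by split=> // L' N lL' rL'; apply: emax; apply/asboolP; exists L'.
Qed.

Lemma maxlattice_sum e L1 L2 :
  maxlattice e L1 -> maxlattice e L2 -> maxlattice e (sumL L1 L2).
Proof.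
move=> [l1 r1 emax] [l2 r2 _]; split=> //; first exact: lattice_sum.
exact: rk_sum.
Qed.

Lemma maxlattice_tr e a L : maxlattice e L -> maxlattice e (tr a L).
Proof. by move=> [l1 r1 emax]; split=> //; [exact: lattice_tr|exact: rk_tr]. Qed.

Lemma maxlattice_proper e L : (0 < e)%N -> maxlattice e L -> exists2 t, L t & ~ mL L t.
Proof.
case: e => // e _ [lL [t [Lt ft]] _]; exists (t ord0) => // h.
have /rowP/(_ ord0) : delta_mx 0 ord0 = 0 :> 'rV[F]_e.+1 by apply: ft; rewrite comb_delta.
by rewrite !mxE !eqxx => /eqP; rewrite oner_eq0.
Qed.

(* The union of all lattices of maximal dimension; it is directed. *)
Definition reach e y := exists2 L, maxlattice e L & L y.

(** Sums of maximal lattices give additivity, and their translates give stability under every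
    [bar a]. *)
Lemma reach_lideal e L : maxlattice e L -> lideal (reach e).
Proof.
move=> mL0; have sr : subsp (reach e).
  split; first by exists L => //; case: mL0 => -[[]].
  move=> k y z [L1 m1 h1] [L2 m2 h2]; exists (sumL L1 L2).
    exact: maxlattice_sum.
  exists (k *: y), z; split=> //; apply: subspZ => //.
  by case: m1 => -[].
split=> // u y [L1 m1 h1].
apply: (@inFS_ind (fun=> True) (fun u => reach e (u * y))) => //.
  exact: subsp_mulr.
move=> a _; exists (tr a L1); first exact: maxlattice_tr.
by apply/subsp_barNK => //; case: m1 => -[].
Qed.

(** The left ideal [reach e] is strictly larger than [I], so [Imax] puts a nonzero [y] of F*B in it;
    moving [bar a] past [y] in [bar a * y] and normalising gives [z]. *)
Lemma reach_monic e L a : (0 < e)%N -> maxlattice e L ->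
  exists2 z, monic z & reach e (z * bar a).
Proof.
move=> e0 m0; have lr := reach_lideal m0.
have [t Lt nt] := maxlattice_proper e0 m0.
have [||y [By y0 ry]] := Imax lr.
- by move=> y Iy; exists L => //; case: m0 => -[_ IL _] _ _; apply: IL.
- exists t; first by exists L.
  by move=> It; apply: nt; apply: mL_I => //; case: m0.
have [z [Bz e1 z0]] := bar_swap a By.
have [|b [k [_ _ mz]]] := monic_normal Bz; first by rewrite z0.
exists (k *: (bar (- b) * z)) => //.
have [sr mr] := lr; rewrite -scalerAl -mulrA -e1; apply: (subspZ _ sr).
by apply: (mr _ _ (mr _ _ ry)).
Qed.

Lemma maxlattice_monic e L (S : seq A) : (0 < e)%N -> maxlattice e L ->
  exists2 M, maxlattice e M & forall a, a \in S -> exists2 z, monic z & M (z * bar a).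
Proof.
move=> e0 m0; elim: S => [|a S [M mM hM]]; first by exists L.
have [z mz [M' mM' hz]] := reach_monic a e0 m0.
have [lM lM'] : lattice M /\ lattice M' by case: mM mM' => ? _ _ [].
exists (sumL M' M); first exact: maxlattice_sum.
move=> c; rewrite inE => /orP[/eqP ->|/hM[w mw Mw]]; [exists z|exists w] => //.
  exact: sumLl.
exact: sumLr.
Qed.

(** Normalise the pair of Ore multipliers by its common leading term. As [y] and [z] are monic,
    comparing both sides modulo negative terms shows that the two leading scalars agree. *)
Lemma monic_ore y z : monic y -> monic z ->
  exists h g, [/\ monic h, monic g & h * y = g * z].
Proof.
move=> my mz.
have [h [g [Bh Bg h0 e]]] := inFB_ore (monic_inFB my) (monic_inFB mz) (monic_neq0 mz).
pose f (i : 'I_2) := if i == ord0 then h else g.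
have [||b [k [m [hb [j kj] mneg fe]]]] := @leading_term 2 f.
- by move=> i; rewrite /f; case: ifP.
- by exists ord0.
pose i1 : 'I_2 := lift ord0 ord0.
have e0 : bar (- b) * h = k ord0 *: 1 + m ord0 by rewrite -fe.
have e1 : bar (- b) * g = k i1 *: 1 + m i1 by rewrite -fe.
have negl i w : monic w -> inFS neg ((k i *: 1 + m i) * w - k i *: 1).
  move=> mw; have -> : (k i *: 1 + m i) * w - k i *: 1 = k i *: (w - 1) + m i * w.
    by rewrite mulrDl -scalerAl mul1r scalerBr addrAC.
  apply: inFSD; first exact: inFSZ.
  apply: inFSM (mneg i) (monic_nonpos mw) => a c ha hc.
  by rewrite addrC; apply: nonpos_neg.
have k01 : k ord0 = k i1.
  have : inFS neg ((k ord0 - k i1) *: 1).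
    have -> : (k ord0 - k i1) *: 1 = ((k i1 *: 1 + m i1) * z - k i1 *: 1) -
                              ((k ord0 *: 1 + m ord0) * y - k ord0 *: 1).
      by rewrite -e0 -e1 -!mulrA e opprB [RHS]addrC addrA subrK scalerBl.
    by apply: inFSB; exact: negl.
  move=> h1; apply/eqP; rewrite -subr_eq0; apply: contra_notT neg0 => kn.
  by apply: h1; rewrite coefZ mulf_neq0 ?coef1_0.
have k0 : k ord0 != 0.
  by case: (unliftP ord0 j) kj => [j'|] -> //; rewrite ord1 -/i1 -k01.
exists ((k ord0)^-1 *: (bar (- b) * h)), ((k ord0)^-1 *: (bar (- b) * g)); split.
- rewrite /monic e0 scalerDr scalerA mulVf // scale1r addrC addKr.
  exact: inFSZ.
- rewrite /monic e1 -k01 scalerDr scalerA mulVf // scale1r addrC addKr.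
  exact: inFSZ.
- by rewrite -!scalerAl -!mulrA e.
Qed.

(** The saturation of [L]: the preimage of its localisation at the monic elements. *)
Definition sat L u := exists2 z, monic z & L (z * u).

Lemma sat_sat L u : sat (sat L) u -> sat L u.
Proof.
move=> [z mz [w mw h]]; exists (w * z); first exact: monicM.
by rewrite -mulrA.
Qed.

Lemma sat_lattice L : lattice L -> lattice (sat L).
Proof.
move=> lL; have [sL IL PL] := lL; split; [split| |].
- by exists 1; [exact: monic1|rewrite mulr0; case: sL].
- move=> k u v [z mz zu] [w mw wv]; have [h [g [mh mg e]]] := monic_ore mz mw.
  exists (h * z); first exact: monicM.
  rewrite mulrDr -scalerAr {2}e -!mulrA; case: sL => _; apply.
    exact: lattice_nonpos (monic_nonpos mh) zu.
  exact: lattice_nonpos (monic_nonpos mg) wv.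
- by move=> y Iy; exists 1; [exact: monic1|rewrite mul1r; apply: IL].
- move=> p y Pp [z mz zy]; have [w mw e] := monic_swap p mz.
  by exists w => //; rewrite mulrA -e -mulrA; apply: PL.
Qed.

(** For [b < 0], if a monic sends [bar (- b) * t] into [L], then some monic [w] has [w * t] in
    [mL L]; since [(w - 1) * t] lies there too, so does [t]. *)
Lemma sat_proper L t : lattice L -> L t -> ~ mL L t -> exists u, ~ sat L u.
Proof.
move=> lL Lt nt; have [b nb] := ex_neg; exists (bar (- b) * t) => -[z mz h].
have [w mw e] := monic_swapV (- b) mz.
apply: nt; rewrite -[t](subKr (w * t)); apply: (subspB (mL_subsp lL)).
  by exists b => //; rewrite /tr mulrA -e -mulrA.
have -> : w * t - t = (w - 1) * t by rewrite mulrBl mul1r.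
exact: mL_neg.
Qed.

(** For [Q] stable under [P], this set indexes the generators of [mL (J Q)], as [mL_J] shows;
    [shiftset] below indexes a sum of translates of [J Q]. *)
Definition addneg Q a := exists2 b, neg b & Q (a - b).
Definition shiftset (S : seq A) Q a := exists2 s, s \in S & Q (a - s).

Lemma lattice_J Q : (forall p a, P p -> Q a -> Q (p + a)) -> lattice (J Q).
Proof.
move=> h; split; [exact: J_subsp|exact: J_I|].
by move=> p y Pp; apply: J_mulbar => a; apply: h.
Qed.

Lemma mL_J Q y : (forall p a, P p -> Q a -> Q (p + a)) ->
  mL (J Q) y <-> J (addneg Q) y.
Proof.
move=> h; have lQ := lattice_J h; split=> [[b nb]|].
  have PQ a : Q a -> addneg Q (b + a) by move=> Qa; exists b; rewrite // addrC addKr.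
  move/(J_mulbar PQ); rewrite barKN.
  exact: (subspZV (@J_subsp _) (tauM_neq0 _ _ _ _)).
apply: J_ind; [exact: mL_subsp|by move=> u; exact: mL_I|].
move=> a [b nb Qab]; exists b => //; rewrite /tr barM addrC.
by apply: (subspZ _ (@J_subsp _)); apply: J_bar.
Qed.

Section NoncontractingTranslates.
Hypothesis P_good : ~ J (addneg P) 1.

Lemma JP_maxlattice : exists e L, (0 < e)%N /\ maxlattice e L.
Proof.
have lP : lattice (J P) by apply: lattice_J; exact: PD.
apply: (maxlattice_ex lP); exists (fun=> 1); split=> [_|c].
  by apply/J_one/J_bar/P_nonpos/nonpos0.
rewrite /comb big_ord1 => h; apply/rowP => i; rewrite ord1 mxE.
apply/eqP/negPn/negP => c0; apply: P_good; apply/mL_J; first exact: PD.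
exact: (subspZV (mL_subsp lP) c0).
Qed.

(* If [E = J(S + P)] equals [m E], it is [B]-stable because the order is
   archimedean.  A maximal lattice can be enlarged so that its saturation contains
   sufficiently many translates of [E], and then it is all of [F*A]. *)
Lemma noncontracting0 (S : seq A) : 0 \in S ->
  ~ (forall s, s \in S -> J (addneg (shiftset S P)) (bar s)).
Proof.
move=> S0 hS; set Q := shiftset S P in hS.
have PQ p a : P p -> Q a -> Q (p + a).
  by move=> Pp [s sS h]; exists s => //; rewrite -addrA; apply: PD.
have lQ := lattice_J PQ.
have [b nb hb] : exists2 b, neg b & forall s, s \in S -> tr b (J Q) (bar s).
  have : forall s, s \in S -> mL (J Q) (bar s) by move=> s /hS/mL_J; exact.
  elim: (S) => [|s S' IH] h; first by have [b nb] := ex_neg; exists b.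
  have [|b1 n1 h1] := IH; first by move=> a aS; apply: h; rewrite inE aS orbT.
  have [|b2 n2 h2] := h s; first by rewrite inE eqxx.
  have [b [nb l1 l2]] := neg_max n1 n2; exists b => // a; rewrite inE.
  have [B1 B2 B0] : [/\ inB b1, inB b2 & inB b] by case: n1 n2 nb => ? _ [? _] [].
  case/orP=> [/eqP ->|/h1 h1']; first exact: tr_mono h2.
  exact: tr_mono h1'.
have hJ y : J Q y -> tr b (J Q) y.
  have [sT IT PT] := lattice_tr b lQ.
  apply: J_ind => // a [s sS Pas].
  rewrite -(subrK s a); apply: (subspZV sT (tau_neq0 (a - s) s)); rewrite -barM.
  by apply: PT => //; apply: hb.
have hJn k y : J Q y -> tr (b *+ k) (J Q) y.
  elim: k y => [|k IH] y Jy.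
    rewrite /tr mulr0n oppr0 bar0 mulr_algl.
    exact: (subspZ _ (@J_subsp _)).
  rewrite /tr mulrS opprD addrC; apply/(subsp_barMD _ _ _ (@J_subsp Q)).
  by apply: (IH); apply: hJ.
(* Some multiple of [b] lies below [- c]; since [bar 0] lies in the translate of [J Q] by that
   multiple, it lies in the translate by [- c]. *)
have hB c : inB c -> J Q (bar c).
  move=> cB; have [k hk] := expn_small (phi_gt0 b) (proj2 nb) (phi_gt0 (- c)).
  have : tr (- c) (J Q) (bar 0).
    apply: (@tr_mono _ (b *+ k)) => //; first 1 last.
    - exact: inBN.
    - by rewrite phiMn.
    - apply: hJn; apply: J_bar; exists 0 => //; rewrite subr0.
      exact/P_nonpos/nonpos0.
    - elim: k {hk} => [|k IH]; first exact: inB0.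
      by rewrite mulrS; apply: inBD => //; case: nb.
  rewrite /tr opprK barM addr0.
  exact: (subspZV (@J_subsp _) (tau_neq0 _ _)).
have [e [L0 [e0 m0]]] := JP_maxlattice.
(* With the sums [s + s1] captured up to monics, [sat L] contains each [bar s1 * J Q], hence all of
   [J (FBset S1)]. *)
have [L mL1 hL] := maxlattice_monic [seq s + s1 | s <- S, s1 <- S1] e0 m0.
have lL : lattice L by case: mL1.
have [t Lt nt] := maxlattice_proper e0 mL1.
have lS := sat_lattice lL; have [sS IS PS] := lS.
have [w nw] := sat_proper lL Lt nt; apply: nw; apply: sat_sat.
have hFB y : J (FBset S1) y -> sat L y.
  apply: J_ind => // a [s1 s1S hs1].
  have : sat L (bar s1 * bar (a - s1)).
    apply: (@J_ind Q (fun y => sat L (bar s1 * y))) (hB _ hs1).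
    - exact: subsp_mull.
    - by move=> v Iv; apply/IS/I_mul.
    move=> c [s sS' Pcs]; rewrite barM; apply: (subspZ _ sS).
    have -> : s1 + c = (c - s) + (s + s1) by rewrite addrA subrK addrC.
    apply: (subspZV sS (tau_neq0 (c - s) (s + s1))); rewrite -barM.
    apply: PS => //; apply: hL; apply/allpairsP; exists (s, s1); split=> //.
  rewrite barM [s1 + _]addrC subrK; exact: (subspZV sS (tau_neq0 _ _)).
(* A monic multiple of the arbitrary [w] lies in [J (FBset S1)], so [w] lies in [sat (sat L)]. *)
have [z [Bz z0 hz]] := spanS1 w.
have [b' [k [hb' _ mz]]] := monic_normal Bz z0.
exists (k *: (bar (- b') * z)) => //; apply: hFB.
rewrite -scalerAl -mulrA; apply: (subspZ _ (@J_subsp _)).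
by case: (FBmod_FBset S1) => _; apply=> //; exact: inBN.
Qed.

Lemma noncontracting (S : seq A) s0 : s0 \in S ->
  ~ (forall s, s \in S -> J (addneg (shiftset S P)) (bar s)).
Proof.
move=> s0S hS; apply: (@noncontracting0 [seq s - s0 | s <- S]).
  by apply/mapP; exists s0; rewrite ?subrr.
move=> _ /mapP[s /hS hs ->]; apply: J_barD hs => c [b nb [s1 s1S h]].
exists b => //; exists (s1 - s0); first by apply/mapP; exists s1.
by rewrite opprB -[- s0 + c - b]addrA addrACA addNr add0r.
Qed.

End NoncontractingTranslates.
End Lattices.

(** * The maximal monoid *)

Definition goodP P := [/\ forall b, nonpos b -> P b,
  forall a b, P a -> P b -> P (a + b) & ~ J (addneg P) 1].

(** If [1] were congruent modulo [I] to some [z] with negative support, [1 - z] would be a nonzero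
    element of F*B in [I]. *)
Lemma goodP_nonpos : goodP nonpos.
Proof.
split=> //; first exact: nonposD.
case=> z Qz Iz; have zneg : inFS neg z.
  by apply: inFS_sub Qz => a [b nb]; move/nonpos_neg => /(_ _ nb); rewrite subrK.
have /monic_neq0/eqP : monic (1 - z).
  by rewrite /monic addrAC subrr sub0r; apply: (subspN (@inFS_subsp _)).
apply; apply: IB => //; apply: inFSB; first exact: inFS1 inB0.
by apply: inFS_sub zneg => a [].
Qed.

Lemma goodP_max : exists2 P, goodP P &
  forall P', goodP P' -> (forall a, P a -> P' a) -> forall a, P' a -> P a.
Proof.
have [||P gP Pmax] := @Zorn_nonempty A goodP; last by exists P.
  by exists nonpos; exact: goodP_nonpos.
move=> C Cg Ctot [X0 CX0]; split.
- by move=> b nb; exists X0 => //; case: (Cg _ CX0) => h _ _; apply: h.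
- move=> a b [X CX Xa] [Y CY Yb]; have [XY|YX] := Ctot _ _ CX CY.
    by exists Y => //; case: (Cg _ CY) => _ h _; apply: h => //; apply: XY.
  by exists X => //; case: (Cg _ CX) => _ h _; apply: h => //; apply: YX.
case/J_finite => s sC Js.
(* The finite support witnessing a bad union lies in a single member of the chain. *)
have [X CX hX] : exists2 X, C X & forall a, a \in s -> addneg X a.
  elim: s sC {Js} => [|a s IH] h; first by exists X0.
  have [|X CX hX] := IH; first by move=> c cs; apply: h; rewrite inE cs orbT.
  have [|b nb [Y CY Yab]] := h a; first by rewrite inE eqxx.
  have [XY|YX] := Ctot _ _ CX CY.
    exists Y => // c; rewrite inE => /orP[/eqP ->|/hX[b' nb' h']]; first by exists b.
    by exists b' => //; apply: XY.
  exists X => // c; rewrite inE => /orP[/eqP ->|/hX //].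
  by exists b => //; apply: YX.
case: (Cg _ CX) => _ _; apply; exact: J_mono hX Js.
Qed.

Section MaximalMonoid.
Variable P : A -> Prop.
Hypothesis P_good : goodP P.
Hypothesis P_max :
  forall P', goodP P' -> (forall a, P a -> P' a) -> forall a, P' a -> P a.

Let P_nonpos b : nonpos b -> P b. Proof. by case: P_good => h _ _; apply: h. Qed.
Let PD a b : P a -> P b -> P (a + b). Proof. by case: P_good => _ h _; apply: h. Qed.
Let PJ : ~ J (addneg P) 1. Proof. by case: P_good. Qed.

Let P0 : P 0. Proof. exact/P_nonpos/nonpos0. Qed.

Lemma PMn a (k : nat) : P a -> P (a *+ k).
Proof. by move=> Pa; elim: k => [//|k IH]; rewrite mulrS; apply: PD. Qed.

(** Bounding the multiples of [a] filters the monoid generated by [P] and [a] by finite unions of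
    translates of [P]. *)
Definition adjoin a (N : nat) c := exists p i, [/\ (i <= N)%N, P p & c = p + a *+ i].

(** By maximality the enlarged monoid is not good; the failure involves finitely many elements,
    hence boundedly many copies of [a]. *)
Lemma adjoin_contract a : ~ P a -> exists N, J (addneg (adjoin a N)) 1.
Proof.
move=> nPa; pose P' c := exists N, adjoin a N c.
have PP' c : P c -> P' c by move=> Pc; exists 0%N, c, 0%N; rewrite mulr0n addr0.
have : ~ goodP P'.
  move=> gP'; apply: nPa; apply: (P_max gP') => //.
  by exists 1%N, 0, 1%N; rewrite mulr1n add0r.
move=> ngP'; have : J (addneg P') 1.
  apply: contrapT => h; apply: ngP'; split=> //; first by move=> b /P_nonpos/PP'.
  move=> c d [N [p [i [iN Pp ->]]]] [N' [p' [i' [iN' Pp' ->]]]].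
  exists (N + N')%N, (p + p'), (i + i')%N; split; [exact: leq_add|exact: PD|].
  by rewrite mulrnDr addrACA.
case/J_finite => s sP Js.
have [N hN] : exists N, forall c, c \in s -> addneg (adjoin a N) c.
  elim: s sP {Js} => [|c s IH] h; first by exists 0%N.
  have [|N hN] := IH; first by move=> d ds; apply: h; rewrite inE ds orbT.
  have [|b nb [N' [p [i [iN' Pp e]]]]] := h c; first by rewrite inE eqxx.
  exists (N + N')%N => d; rewrite inE => /orP[/eqP ->|/hN[b' nb' [p' [i' [iN Pp' e']]]]].
    by exists b => //; exists p, i; split=> //; apply: leq_trans iN' (leq_addl _ _).
  by exists b' => //; exists p', i'; split=> //; apply: leq_trans iN (leq_addr _ _).
by exists N; exact: J_mono hN Js.
Qed.

(** If both adjunctions contracted, the sum of the translates of [J P] by [0, a, ..., (N + N') a]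
    would contract too, against [noncontracting]. *)
Lemma P_total a : P a \/ P (- a).
Proof.
apply: contrapT => /not_orP[/adjoin_contract[N JN] /adjoin_contract[N' JN']].
pose S := [seq a *+ i | i <- iota 0 (N + N').+1].
have inS i : (i <= N + N')%N -> a *+ i \in S.
  by move=> h; apply/mapP; exists i; rewrite // mem_iota.
apply: (@noncontracting P P_nonpos PD PJ S (a *+ 0)); first exact: inS.
move=> s /mapP[i]; rewrite mem_iota add0n ltnS /= => iN ->.
(* For [i <= N'] the relation for [a] raises [i] by at most [N]; for larger [i] the relation for
   [- a] lowers it by at most [N']. Both stay in range. *)
rewrite -[a *+ i]add0r; have [le|lt] := leqP i N'.
  move/J_one: JN; apply: J_barD => c [b nb [p [j [jN Pp e]]]]; exists b => //.
  exists (a *+ (i + j)); first by apply: inS; rewrite addnC leq_add.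
  by rewrite -[a *+ i + c - b]addrA e mulrnDr opprD addrACA subrr add0r addrK.
move/J_one: JN'; apply: J_barD => c [b nb [p [j [jN Pp e]]]]; exists b => //.
have ji : (j <= i)%N by apply: leq_trans jN (ltnW lt).
exists (a *+ (i - j)); first by apply: inS; apply: leq_trans (leq_subr _ _) iN.
rewrite -[a *+ i + c - b]addrA e mulrnBr // opprB mulNrn [a *+ j - _]addrC addrACA.
by rewrite subrr add0r subrK.
Qed.

Lemma P_inB b : inB b -> P b -> nonpos b.
Proof.
move=> hb Pb; have [//|nb] := nonposVneg hb; case: PJ.
by apply/J_one/J_bar; exists (- b); rewrite // opprK add0r.
Qed.

Lemma P_inB0 b : inB b -> P b -> P (- b) -> b = 0.
Proof.
move=> hb /(P_inB hb)[_ b1] /(P_inB (inBN hb))[_]; rewrite phiN invf_le1 // => b1'.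
by apply: phi_inj => //; apply/eqP; rewrite eq_le b1 b1'.
Qed.

(* If [1] lies in [p J(P)], then [J(P)] is already stable under [- p], so
   adjoining [- p] to [P] does not make it contract. *)
Lemma J_translate_max p : P p -> J (fun c => P (c - p)) 1 -> P (- p).
Proof.
move=> Pp J1; apply: contrapT => /adjoin_contract[N JN].
have Jk k : J (fun c => P (c - p *+ k)) (bar 0).
  elim: k => [|k IH]; first by apply: J_bar; rewrite mulr0n subr0.
  apply: J_bind IH => c Pc; rewrite -[c]add0r; move/J_one: J1; apply: J_barD => d Pd.
  by rewrite mulrS opprD [- p - _]addrC addrACA; apply: PD.
have JpN : J (addneg P) (bar (0 + p *+ N)).
  move/J_one: JN; apply: J_barD => c [b nb [q [i [iN Pq e]]]]; exists b => //.
  rewrite -[p *+ N + c - b]addrA e mulNrn addrCA -mulrnBr //.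
  by apply: PD => //; exact: PMn.
apply: PJ; apply/J_one; apply: J_bind (Jk N) => c Pc.
have -> : c = 0 + p *+ N + (c - p *+ N) by rewrite add0r addrC subrK.
apply: J_barD JpN => d [b nb h].
by exists b => //; rewrite -addrA; apply: PD.
Qed.

(** More powers of [bar x] than the rank satisfy a relation over F*B modulo [I]. If the claim
    failed, [P] would strictly order the elements [b + i x]. Dividing the relation by its largest
    term expresses [1] modulo [I] by strictly negative elements; with [p] the largest of them,
    [J_translate_max] gives [- p] in [P], a contradiction. *)
Lemma slope x : exists (s : nat) b,
  [/\ (0 < s)%N, inB b, P (x *+ s - b) & P (- (x *+ s - b))].
Proof.
apply: contrapT => H.
(* Equivalent elements [b + i x] and [b' + i' x] with [i < i'] would give the claim with
   [s = i' - i]. *)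
have lt_distinct a a' i i' : (i < i')%N -> inB (a - x *+ i) -> inB (a' - x *+ i') ->
    P (a - a') -> P (a' - a) -> False.
  move=> lt ha ha' h h'; apply: H; exists (i' - i)%N, (a - x *+ i - (a' - x *+ i')).
  have e : x *+ (i' - i) - (a - x *+ i - (a' - x *+ i')) = a' - a.
    rewrite mulrnBr 1?ltnW // !opprB [a' - _ + _]addrC !addrA subrK.
    by rewrite addrC !addrA addNr add0r addrC.
  rewrite e; split=> //; [by rewrite subn_gt0| |by rewrite opprB].
  by apply: inBD => //; exact: inBN.
have distinct a a' i i' : inB (a - x *+ i) -> inB (a' - x *+ i') ->
    P (a - a') -> P (a' - a) -> i = i' /\ a = a'.
  move=> ha ha' h h'; case: (ltngtP i i') => [lt|lt|e].
  - by case: (lt_distinct _ _ _ _ lt ha ha' h h').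
  - by case: (lt_distinct _ _ _ _ lt ha' ha h' h).
  split=> //; apply/eqP; rewrite -subr_eq0; apply/eqP; apply: P_inB0 => //.
    have -> : a - a' = (a - x *+ i) - (a' - x *+ i') by rewrite e opprB addrA subrK.
    by apply: inBD => //; exact: inBN.
  by rewrite opprB.
have Rxx a : P (a - a) by rewrite subrr; exact: P0.
pose N := (size S1).+1; pose t (i : 'I_N) := bar (x *+ i).
have [h [hB hI [i0 hi0]]] : exists h : 'I_N -> FA, [/\ forall i, inFB (h i),
    I (\sum_i h i * t i) & exists i, h i != 0].
  apply: contrapT => nh; suff /(spanning_rank spanS1) : FBfree t by rewrite ltnn.
  move=> h hB hI i; apply/eqP/negPn/negP => hi; apply: nh.
  by exists h; split=> //; exists i.
set y := \sum_i h i * t i in hI.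
have ysupp a : coef y a != 0 -> exists i : 'I_N, inB (a - x *+ i).
  rewrite coef_sum => ya; apply: contrapT => na; case/eqP: ya; apply: big1 => i _.
  rewrite coef_barMr; apply/eqP; rewrite mulf_eq0; apply/orP; right.
  by apply/negPn/negP => /hB ha; apply: na; exists i.
have [b0 hb0] := neq0_coef hi0.
(* By [distinct] the supports of the summands of [y] are disjoint, so nothing cancels. *)
have y0 : coef y (b0 + x *+ i0) != 0.
  rewrite coef_sum (bigD1 i0) //= big1 => [|i ni].
    by rewrite addr0 coef_barMr mulf_neq0 ?tau_neq0 // addrK.
  rewrite coef_barMr; apply/eqP; rewrite mulf_eq0; apply/orP; right.
  apply/negPn/negP => /hB ha; case/eqP: ni; apply: val_inj => /=.
  have hb : inB (b0 + x *+ i0 - x *+ i0) by rewrite addrK; exact: (hB i0).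
  by have [] := distinct _ _ _ _ ha hb (Rxx _) (Rxx _).
pose s := [seq a <- supp y | coef y a != 0].
have sP a : a \in s <-> coef y a != 0.
  rewrite mem_filter; split=> [/andP[]//|ya]; rewrite ya /=.
  by apply: contraNT ya => /coef_out ->.
have Rtr a b c : P (a - b) -> P (b - c) -> P (a - c).
  by move=> h1 h2; rewrite -(subrK b a) -addrA; apply: PD.
have Rtot a b : P (a - b) \/ P (b - a).
  by rewrite -[b - a]opprB; exact: P_total.
(* [P (a - b)] is read as [a <= b]; by [distinct] no other support element is equivalent to the
   largest one [a0]. *)
have [|a0 /sP a0s a0max] := @seq_max _ (fun a b => P (a - b)) s Rxx Rtr Rtot.
  by move/sP: y0; apply: contraTneq => ->.
pose k := coef (bar (- a0) * y) 0 / coef 1 0.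
have k0 : k != 0.
  rewrite mulf_neq0 ?invr_eq0 ?coef1_0 //.
  by rewrite coef_barMl mulf_neq0 ?tau_neq0 // sub0r opprK.
pose s' := [seq a - a0 | a <- s & a != a0].
have J1 : J (fun c => c \in s') 1.
  exists (1 - k^-1 *: (bar (- a0) * y)); last first.
    by rewrite subKr; apply: (subspZ _ I_subsp); exact: I_mul.
  move=> c; rewrite addrC -scaleNr coef_linear.
  have [->|c0] := eqVneq c 0.
    by rewrite /k invf_div mulNr divfK ?addNr ?eqxx //;
      apply: contraNneq k0; rewrite /k => ->; rewrite mul0r.
  have -> : coef 1 c = 0.
    apply: contraNeq c0 => h1; exact: (@inFS1 (fun a => a == 0) (eqxx _) _ h1).
  rewrite addr0 mulf_eq0 negb_or coef_barMl mulf_eq0 negb_or opprK => /and3P[_ _ hc].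
  apply/mapP; exists (c + a0); last by rewrite addrK.
  rewrite mem_filter; apply/andP; split; last exact/sP.
  by apply: contraNneq c0 => e; rewrite -(addrK a0 c) e subrr.
have s'P c : c \in s' -> P c /\ ~ P (- c).
  case/mapP=> a; rewrite mem_filter => /andP[na aS] ->; split; first exact: a0max.
  rewrite opprB => h1; case/eqP: na; have /ysupp[i hi] := (sP a).1 aS.
  have [i' hi'] := ysupp _ a0s.
  by have [] := distinct _ _ _ _ hi hi' (a0max _ aS) h1.
have [s'0|s'n] := eqVneq s' [::].
  move: J1; rewrite s'0 => -[z Qz]; have -> : z = 0.
    by apply: coef_inj => a; rewrite coef0; apply/eqP/negPn/negP => /Qz.
  rewrite subr0 => /IB h1; have /eqP := h1 (inFS1 inB0); by rewrite oner_eq0.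
have [p ps pmax] := @seq_max _ (fun a b => P (a - b)) s' Rxx Rtr Rtot s'n.
have [Pp nPp] := s'P p ps; apply: nPp; apply: J_translate_max => //.
exact: J_mono pmax J1.
Qed.

(** A basis of [J P] modulo [mL (J P)]: independent families have bounded size, and [1] gives a
    nonempty one. *)
Lemma rk_JP_basis : exists e (t : 'I_e -> FA), [/\ (0 < e)%N,
  forall i, J P (t i),
  forall c : 'rV[F]_e, mL (J P) (comb c t) -> c = 0 &
  forall y, J P y -> exists v : 'rV[F]_e, mL (J P) (y - comb v t)].
Proof.
have lP := @lattice_J P P PD; have sm := @mL_subsp P P_nonpos _ lP.
pose ok N := `[< rk (J P) N >].
have ok1 : ok 1%N.
  apply/asboolP; exists (fun=> 1); split=> [_|c].
    by apply/J_one/J_bar; exact: P0.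
  rewrite /comb big_ord1 => h; apply/rowP => i; rewrite ord1 mxE.
  apply/eqP/negPn/negP => c0; apply: PJ; apply/(@mL_J P P_nonpos P); first exact: PD.
  exact: (subspZV sm c0).
have bd N : ok N -> (N <= size S1)%N by move/asboolP; exact: (rk_bound P_nonpos lP).
case: (ex_maxnP (ex_intro _ 1%N ok1) bd) => e /asboolP[t [Lt ft]] emax.
exists e, t; split=> //; first exact: emax.
move=> y Jy; apply: contrapT => nv; suff : (e.+1 <= e)%N by rewrite ltnn.
apply: emax; apply/asboolP.
exists (fun i => if unlift ord0 i is Some j then t j else y); split=> [i|c].
  by case: unlift.
rewrite /comb big_ord_recl unlift_none; under eq_bigr do rewrite liftK.
pose c' : 'rV[F]_e := \row_j c 0 (lift ord0 j).
have -> : \sum_(i < e) c 0 (lift ord0 i) *: t i = comb c' t.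
  by apply: eq_bigr => i _; rewrite mxE.
have [c0|c0] := eqVneq (c 0 ord0) 0.
  rewrite c0 scale0r add0r => /ft/rowP c'0; apply/rowP => i; rewrite mxE.
  case: (unliftP ord0 i) => [j|] -> //.
  by have := c'0 j; rewrite !mxE.
move=> h; case: nv; exists (- (c 0 ord0)^-1 *: c').
apply: (subspZV sm c0); rewrite scalerBr.
by rewrite combZ scalerA mulrN divff // scaleN1r opprK.
Qed.

(** Both elements act by invertible matrices of size [e]; the commutation rule becomes
    [M' M = k M M'], and determinants give [1 = k^e]. *)
Lemma neutral_root_of_unity : exists2 e : nat, (0 < e)%N &
  forall c c' (k : F), P c -> P (- c) -> P c' -> P (- c') ->
  bar c * bar c' = k *: (bar c' * bar c) -> k ^+ e = 1.
Proof.
have [e [t [e0 Jt ft st]]] := rk_JP_basis; exists e => //.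
have lP := lattice_J PD; have sm := mL_subsp P_nonpos lP.
have act c : P c -> exists M : 'M[F]_e, forall i, mL (J P) (bar c * t i - comb (row i M) t).
  move=> Pc; have /choice[v vP] i : exists v : 'rV[F]_e, mL (J P) (bar c * t i - comb v t).
    by apply: st; case: lP => _ _; apply.
  by exists (\matrix_i v i) => i; rewrite rowK.
(* Rows hold the images of basis vectors, so composition reverses the matrix product. *)
have actM c c' (M M' : 'M[F]_e) : P c ->
    (forall i, mL (J P) (bar c * t i - comb (row i M) t)) ->
    (forall i, mL (J P) (bar c' * t i - comb (row i M') t)) ->
    forall i, mL (J P) (bar c * (bar c' * t i) - comb (row i (M' *m M)) t).
  move=> Pc hM hM' i.
  have -> : bar c * (bar c' * t i) - comb (row i (M' *m M)) t =
      bar c * (bar c' * t i - comb (row i M') t) +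
      comb (row i M') (fun j => bar c * t j - comb (row j M) t).
    rewrite combB mulrBr row_mul comb_mulmx /comb mulr_sumr.
    under [X in _ + (X - _)]eq_bigr do rewrite scalerAr.
    by rewrite addrA subrK.
  apply: (subspD sm); last exact: comb_subsp.
  have [b nb hb] := hM' i; exists b => //.
  by have [_ _ PT] := lattice_tr b lP; apply: PT.
have eq_mx (M M' : 'M[F]_e) : (forall i, mL (J P) (comb (row i M) t - comb (row i M') t)) -> M = M'.
  move=> h; apply/row_matrixP => i; apply/eqP; rewrite -subr_eq0 -scaleN1r addrC; apply/eqP.
  by apply: ft; rewrite comb_is_linear scaleN1r addrC.
have act_unit c M : P c -> P (- c) ->
    (forall i, mL (J P) (bar c * t i - comb (row i M) t)) -> M \in unitmx.
  move=> Pc Pnc hM; have [M' hM'] := act _ Pnc.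
  have kn := tauM_neq0 (- c) c 0 0; set k := tau (- c) c * tau 0 0 in kn.
  have e1 : M *m M' = k%:M.
    apply: eq_mx => i; have := actM _ _ _ _ Pnc hM' hM i; rewrite barNK -/k.
    move/(subspN sm); rewrite opprB; congr mL; congr (_ - _).
    by rewrite rowE mul_mx_scalar combZ comb_delta.
  have : M *m M' \in unitmx by rewrite e1 unitmxE det_scalar unitrX // unitfE.
  by rewrite unitmx_mul => /andP[].
move=> c c' k Pc Pnc Pc' Pnc' comm.
have [M hM] := act _ Pc; have [M' hM'] := act _ Pc'.
have e1 : M' *m M = k *: (M *m M').
  apply: eq_mx => i; have h1 := actM _ _ _ _ Pc hM hM' i.
  have h2 := actM _ _ _ _ Pc' hM' hM i.
  have -> : comb (row i (M' *m M)) t - comb (row i (k *: (M *m M'))) t =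
    k *: (bar c' * (bar c * t i) - comb (row i (M *m M')) t) -
    (bar c * (bar c' * t i) - comb (row i (M' *m M)) t).
    have -> : comb (row i (k *: (M *m M'))) t = k *: comb (row i (M *m M')) t.
      by rewrite linearZ combZ.
    rewrite scalerBr [bar c * (_ * _)]mulrA comm -scalerAl -mulrA.
    by rewrite opprB [RHS]addrC addrA subrK.
  by apply: (subspB sm) => //; apply: (subspZ _ sm).
have [uM uM'] := (act_unit _ _ Pc Pnc hM, act_unit _ _ Pc' Pnc' hM').
have := congr1 determinant e1; rewrite detZ !det_mulmx [\det M' * _]mulrC => /eqP.
rewrite -{1}[X in X == _]mul1r => /eqP/mulIf h; apply/esym/h.
by rewrite mulf_neq0 // -unitfE -unitmxE.
Qed.

End MaximalMonoid.

(** * The commuting elements *)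

Lemma bar_exp a (k : nat) : exists2 d : F, d != 0 & bar a ^+ k = d *: bar (a *+ k).
Proof.
elim: k => [|k [d d0 IH]].
  exists (tau 0 0)^-1; first by rewrite invr_eq0 tau_neq0.
  by rewrite mulr0n bar0 scalerA mulVf ?tau_neq0 // scale1r.
exists (d * tau a (a *+ k)); first by rewrite mulf_neq0 ?tau_neq0.
by rewrite exprS IH -scalerAr barM scalerA mulrS.
Qed.

Lemma commuting_elements : exists (l : 'I_n -> A) (s : 'I_n -> int),
    (forall j : 'I_n, (r <= j)%N -> in_first r (l j) /\ s j != 0) /\
    (forall j k : 'I_n, (r <= j)%N -> (r <= k)%N ->
       (bar (l j) * bar (xgen j) ^ s j) * (bar (l k) * bar (xgen k) ^ s k)
       = (bar (l k) * bar (xgen k) ^ s k) * (bar (l j) * bar (xgen j) ^ s j)).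
Proof.
have [P gP Pmax] := goodP_max.
have [e e0 he] := neutral_root_of_unity gP.
have /choice[f fP] j : exists sb : nat * A, [/\ (0 < sb.1)%N, inB sb.2,
    P (xgen j *+ sb.1 - sb.2) & P (- (xgen j *+ sb.1 - sb.2))].
  by have [s [b h]] := slope gP Pmax (xgen j); exists (s, b).
pose c j := xgen j *+ (f j).1 - (f j).2.
(* Up to a scalar, the [e]-th power of [bar (c j)] has the required form, with [l j = - e b] and
   exponent [e s]. These powers commute because the commutator scalars satisfy [q^e = 1]. *)
have cX j : exists2 d : F, d != 0 &
    bar (- ((f j).2 *+ e)) * bar (xgen j) ^ ((f j).1 * e)%N = d *: bar (c j) ^+ e.
  have [d1 d10 e1] := bar_exp (xgen j) ((f j).1 * e).
  have [d2 d20 e2] := bar_exp (c j) e.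
  exists (d1 * tau (- ((f j).2 *+ e)) (xgen j *+ ((f j).1 * e)) / d2).
    by rewrite !mulf_neq0 ?invr_eq0 ?tau_neq0.
  rewrite -exprnP e1 e2 -scalerAr barM !scalerA divfK //; congr (_ *: bar _).
  by rewrite addrC /c mulrnBl mulrnA.
exists (fun j => - ((f j).2 *+ e)), (fun j => ((f j).1 * e)%N%:Z); split=> [j _|j k _ _].
  have [s0 hb _ _] := fP j; split; last by rewrite -lt0n muln_gt0 s0 e0.
  apply: inBN; elim: (e) => [|m IH]; first by rewrite mulr0n; exact: inB0.
  by rewrite mulrS; apply: inBD.
have [d1 _ ->] := cX j; have [d2 _ ->] := cX k.
have [[_ _ P1 P1'] [_ _ P2 P2']] := (fP j, fP k).
have [q q0 hq] := bar_comm (c j) (c k).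
have q1 := he _ _ _ P1 P1' P2 P2' hq.
have comm1 : bar (c j) * bar (c k) ^+ e = bar (c k) ^+ e * bar (c j).
  have h m : bar (c j) * bar (c k) ^+ m = q ^+ m *: (bar (c k) ^+ m * bar (c j)).
    elim: m => [|m IH]; first by rewrite !expr0 mulr1 mul1r scale1r.
    rewrite [bar (c k) ^+ m.+1]exprS [LHS]mulrA hq -[LHS]scalerAl -[in LHS]mulrA IH.
    by rewrite -scalerAr scalerA [q ^+ m.+1]exprS [in LHS]mulrA.
  by rewrite h q1 scale1r.
have comm2 : bar (c j) ^+ e * bar (c k) ^+ e = bar (c k) ^+ e * bar (c j) ^+ e.
  by apply/commr_sym/commrX/commr_sym.
by rewrite -!scalerAl -!scalerAr !scalerA comm2 mulrC.
Qed.

End TwistedGroupAlgebra.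

(** * An archimedean order, and growth *)

Fixpoint nth_prime (k : nat) : nat :=
  if k is k'.+1 then s2val (prime_above (nth_prime k')) else 2.

Lemma nth_prime_prime k : prime (nth_prime k).
Proof. by case: k => // k /=; case: prime_above. Qed.

Lemma nth_prime_inj : injective nth_prime.
Proof.
have lt i j : (i < j)%N -> (nth_prime i < nth_prime j)%N.
  have step k : (nth_prime k < nth_prime k.+1)%N by rewrite /=; case: prime_above.
  elim: j => // j IH; rewrite ltnS leq_eqVlt => /orP[/eqP -> //|/IH h].
  exact: ltn_trans h (step j).
by move=> i j e; case: (ltngtP i j) => // /lt; rewrite e ltnn.
Qed.

Lemma prime_exponents_inj n (u v : 'I_n -> nat) :
  (\prod_(i < n) nth_prime i ^ u i = \prod_(i < n) nth_prime i ^ v i)%N -> u =1 v.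
Proof.
move=> e j.
have log (w : 'I_n -> nat) : logn (nth_prime j) (\prod_(i < n) nth_prime i ^ w i) = w j.
  rewrite (bigD1 j) //= mulnC logn_Gauss; first by rewrite pfactorK ?nth_prime_prime.
  elim/big_ind: _ => [|x y hx hy|i ij]; first exact: coprimen1.
    by rewrite coprimeMr hx.
  apply: coprimeXr; rewrite prime_coprime ?nth_prime_prime //.
  rewrite dvdn_prime2 ?nth_prime_prime // (inj_eq nth_prime_inj) val_eqE.
  by rewrite eq_sym.
by rewrite -(log u) e log.
Qed.

(* An archimedean order on [Z^n]: the multiplicatively independent primes embed
   it in the ordered group of positive rationals. *)
Lemma archimedean_character n : exists phi : 'rV[int]_n -> rat,
  [/\ forall a b, phi (a + b) = phi a * phi b, forall a, 0 < phi a
    & forall a, phi a = 1 -> a = 0].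
Proof.
pose p (i : 'I_n) : rat := (nth_prime i)%:R.
have p0 i : 0 < p i by rewrite ltr0n prime_gt0 ?nth_prime_prime.
exists (fun a => \prod_(i < n) p i ^ a 0 i); split.
- move=> a b; rewrite -big_split; apply: eq_bigr => i _ /=.
  by rewrite mxE expfzDr ?gt_eqF.
- by move=> a; apply: prodr_gt0 => i _; rewrite exprz_gt0.
(* Splitting exponents into positive and negative parts turns [phi a = 1] into an equality of
   natural numbers, to which unique factorisation applies. *)
move=> a; pose u i := if 0 <= a 0 i then absz (a 0 i) else 0%N.
pose v i := if 0 <= a 0 i then 0%N else absz (a 0 i).
have auv i : a 0 i = (u i)%:Z - (v i)%:Z.
  by rewrite /u /v; case: ifP; move: (a 0 i) => x; lia.
have -> : \prod_(i < n) p i ^ a 0 i =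
    (\prod_(i < n) nth_prime i ^ u i)%N%:R / (\prod_(i < n) nth_prime i ^ v i)%N%:R.
  rewrite !natr_prod -prodf_div; apply: eq_bigr => i _.
  by rewrite auv expfzDr ?gt_eqF // -exprnP -exprnN !natrX.
move/(congr1 (fun x => x * (\prod_(i < n) nth_prime i ^ v i)%N%:R)); rewrite mul1r divfK.
  move/eqP; rewrite eqr_nat => /eqP/prime_exponents_inj uv.
  by apply/rowP => i; rewrite auv uv subrr mxE.
by rewrite pnatr_eq0 -lt0n prodn_gt0 // => i; rewrite expn_gt0 prime_gt0 ?nth_prime_prime.
Qed.

Section GelfandKirillov.
Variables (F : fieldType) (FA : unitAlgType F) (M : lmodType FA).

(** [fdim] only sees subsequences of [l]. Independence makes [g] injective, so its values can be
    rearranged in the order in which they occur in [l]. *)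
Lemma fdim_ge (T : finType) (g : T -> M) (l : seq M) : (forall t, g t \in l) ->
  (forall x : T -> F, \sum_t fscale (x t) (g t) = 0 -> forall t, x t = 0) ->
  (#|T| <= fdim l)%N.
Proof.
move=> gl gfree.
have fs0 m : fscale 0 m = 0 :> M by rewrite /fscale scale0r scale0r.
have g_inj : injective g.
  move=> t t' e; apply/eqP/negPn/negP => nt.
  have := gfree (fun w => if w == t then 1 else if w == t' then -1 else 0).
  have nt' : (t' == t) = false by rewrite eq_sym; apply/negbTE.
  rewrite (bigD1 t) //= (bigD1 t') /=; last by rewrite nt'.
  rewrite !eqxx nt'.
  rewrite big1 => [|w /andP[/negPf -> /negPf ->]]; last exact: fs0.
  rewrite e addr0 /fscale -scalerDl scaleN1r scale1r subrr scale0r.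
  by move=> /(_ erefl t); rewrite eqxx => /eqP; rewrite oner_eq0.
pose X := [seq g t | t <- enum T].
pose sub := [seq z <- undup l | z \in X].
have usub : uniq sub by rewrite filter_uniq ?undup_uniq.
have psub : perm_eq X sub.
  apply: uniq_perm => //; first by rewrite map_inj_uniq ?enum_uniq.
  move=> z; rewrite mem_filter mem_undup; apply/idP/andP => [zX|[]//].
  by split=> //; case/mapP: zX => t _ ->.
have /subseqP[m sm esub] : subseq sub l.
  exact: subseq_trans (filter_subseq _ _) (undup_subseq l).
have szsub : size sub = #|T| by rewrite -(perm_size psub) size_map -cardE.
have fsub : findep sub.
  move=> c hc i isub.
  have [t _ et] : exists2 t, t \in enum T & sub`_i = g t.
    by apply/mapP; rewrite (perm_mem psub) mem_nth.
  rewrite -(index_uniq 0 isub usub) et.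
  apply: (gfree (fun t => c (index (g t) sub))).
  rewrite -[LHS]big_enum -(big_map g xpredT (fun z => fscale (c (index z sub)) z)) /=.
  rewrite (perm_big _ psub) /= -[RHS]hc (big_nth 0) big_mkord; apply: eq_bigr => j _.
  by rewrite index_uniq.
rewrite -szsub esub /fdim.
have mt : size m == size l by rewrite sm.
apply: (@leq_bigmax_cond _ (fun m : (size l).-tuple bool => `[< findep (mask m l) >])
  (fun m => size (mask m l)) (Tuple mt)).
by apply/asboolP; rewrite /= -esub.
Qed.

Lemma limn_esup_ge (u : nat -> \bar Rdefinitions.R) (x : \bar Rdefinitions.R) :
  (forall N, exists2 k, (N <= k)%N & (x <= u k)%E) -> (x <= limn_esup u)%E.
Proof.
move=> h; apply: le_ereal_inf_tmp => /= _ [B [N /= _ NB] <-].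
have [k Nk xk] := h N; apply: le_trans xk _.
by apply: ereal_sup_ubound; exists k => //; apply: NB.
Qed.

(** At arguments [(r+1)^(j+1)] the growth ratio is at least [(r+1) j / (j+1)], which is at least
    [r + 1/2] once [j >= 2r + 1]; so the upper limit exceeds [r]. *)
Lemma gkdim_ge (V : seq FA) (W : seq M) (r : nat) : (0 < r)%N -> 1 \in V ->
  (forall k, (k ^ r.+1 <= fdim (VkW V W (r.+1 * k)))%N) ->
  gkdim M <> ((r%:R : Rdefinitions.R)%:E)%E.
Proof.
move=> r0 V1 hk gk.
have : (limn_esup (gk_ratio V W) <= gkdim M)%E.
  by apply: ereal_sup_ubound; exists V, W.
rewrite gk leNgt => /negP; apply.
apply: (@lt_le_trans _ _ (r%:R + 2^-1)%:E); first by rewrite lte_fin ltrDl invr_gt0 ltr0n.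
apply: limn_esup_ge => N; pose j := (N + 2 * r + 1)%N.
exists (r.+1 ^ j.+1)%N.
  apply: leq_trans (ltnW (ltn_expl _ _)); rewrite // /j; lia.
rewrite /gk_ratio lee_fin.
have L0 : 0 < ln (r.+1%:R : Rdefinitions.R) by rewrite ln_gt0 // ltr1n.
rewrite natrX lnXn ?ltr0n // ler_pdivlMr ?pmulrn_lgt0 //.
have := hk (r.+1 ^ j)%N; rewrite -expnS -expnM => hf.
have f0 : (0 < r.+1 ^ (j * r.+1))%N by rewrite expn_gt0.
have : ln ((r.+1 ^ (j * r.+1))%:R : Rdefinitions.R) <= ln ((fdim (VkW V W (r.+1 ^ j.+1)))%:R).
  by rewrite ler_ln ?posrE ?ltr0n ?ler_nat // (leq_trans f0).
apply: le_trans; rewrite natrX lnXn ?ltr0n //.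
move: (ln _) L0 => L L0; rewrite -!(mulr_natr L) mulrCA ler_pM2l //.
have jr : (2 * r + 1 <= j)%N by rewrite /j; lia.
have : (2 * r + 1)%:R <= j%:R :> Rdefinitions.R by rewrite ler_nat.
rewrite -[j.+1]addn1 -[r.+1]addn1 !(natrM, natrD); nra.
Qed.

End GelfandKirillov.

(** * From a free family to growth, and the conclusion *)

Definition unit_ball (F : fieldType) (n : nat) (FA : unitAlgType F)
    (bar : 'rV[int]_n -> FA) : seq FA :=
  1 :: [seq bar (xgen i) | i <- enum 'I_n] ++ [seq bar (- xgen i) | i <- enum 'I_n].

Lemma words_mul (F : fieldType) (FA : unitAlgType F) (V : seq FA) k v u :
  v \in V -> u \in words V k -> v * u \in words V k.+1.
Proof. by move=> vV uV; apply/allpairsP; exists (v, u). Qed.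

Lemma ball_words (F : fieldType) (n : nat) (FA : unitAlgType F)
  (tau : 'rV[int]_n -> 'rV[int]_n -> F) (bar : 'rV[int]_n -> FA) k a :
  is_twisted_group_algebra tau bar -> a \in ball n k ->
  exists2 c : F, c != 0 & c *: bar a \in words (unit_ball bar) k.
Proof.
move=> tga; elim: k a => [|k IH] a.
  rewrite inE => /eqP ->; exists (tau 0 0)^-1; first by rewrite invr_eq0 (tau_neq0 tga).
  by rewrite (bar0 tga) scalerA mulVf ?(tau_neq0 tga) // scale1r inE.
have step x s : bar x \in unit_ball bar -> s \in ball n k ->
    exists2 c : F, c != 0 & c *: bar (s + x) \in words (unit_ball bar) k.+1.
  move=> xV /IH[c c0 cs]; exists (c * tau x s); first by rewrite mulf_neq0 ?(tau_neq0 tga).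
  by rewrite addrC -scalerA -(barM tga) scalerAr; apply: words_mul.
rewrite [ball _ _]/= !mem_cat; case/or3P => [/IH[c c0 h]|/allpairsP[[s i] /= [sk _ ->]]|
  /allpairsP[[s i] /= [sk _ ->]]].
- exists c => //; rewrite -[_ *: _]mul1r; apply: words_mul => //.
  by rewrite inE eqxx.
- apply: step => //; rewrite inE mem_cat; apply/orP; right; apply/orP; left.
  by apply/mapP; exists i; rewrite ?mem_enum.
- apply: step => //; rewrite inE mem_cat; apply/orP; right; apply/orP; right.
  by apply/mapP; exists i; rewrite ?mem_enum.
Qed.

(** The annihilator of [m] lies in [I], so monomials independent modulo [I] stay independent when
    applied to [m]. Those of [FBfree_box] have word length at most [k + r k]. *)
Lemma FBfree_fdim (F : fieldType) (n : nat) (FA : unitAlgType F)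
  (tau : 'rV[int]_n -> 'rV[int]_n -> F) (bar : 'rV[int]_n -> FA)
  (tga : is_twisted_group_algebra tau bar) (M : lmodType FA) (m : M) (r : nat)
  (I : FA -> Prop) (s : nat -> 'rV[int]_n) (k : nat) : (r <= n)%N ->
  (forall y, y *: m = 0 -> I y) -> (forall j, s j \in ball n j) ->
  FBfree tga r I (fun i : 'I_k => bar (s i)) ->
  (k ^ r.+1 <= fdim (VkW (unit_ball bar) [:: m] (r.+1 * k)))%N.
Proof.
move=> rn annI sball sfree.
have /choice[c cP] (t : 'I_k * {ffun 'I_r -> 'I_k}) : exists c : F, c != 0 /\
    c *: bar (boxvec n t.2 + s t.1) \in words (unit_ball bar) (r.+1 * k).
  have [|c c0 h] := ball_words (a := boxvec n t.2 + s t.1) (k := r.+1 * k) tga.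
    apply: ball_sub (ball_boxvec rn t.2 (sball t.1)).
    by rewrite mulSn leq_add2r ltnW.
  by exists c.
have -> : (k ^ r.+1 = #|{: 'I_k * {ffun 'I_r -> 'I_k}}|)%N.
  by rewrite card_prod card_ffun !card_ord expnS.
apply: (@fdim_ge _ _ _ _ (fun t => (c t *: bar (boxvec n t.2 + s t.1)) *: m)) => [t|x x0 t].
  rewrite /VkW; apply/allpairsP; exists (c t *: bar (boxvec n t.2 + s t.1), m).
  by case: (cP t); rewrite inE.
have [c0 _] := cP t.
suff /eqP : x t * c t = 0 by rewrite mulf_eq0 (negPf c0) orbF => /eqP.
apply: (FBfree_box (x := fun t => x t * c t) _ sfree) => //.
apply: annI; rewrite scaler_suml -[RHS]x0; apply: eq_bigr => w _.
by rewrite /fscale scalerA mulr_algl scalerA.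
Qed.

Theorem theorem4p4 (F : fieldType) (n : nat) (FA : unitAlgType F)
  (tau : 'rV[int]_n -> 'rV[int]_n -> F) (bar : 'rV[int]_n -> FA)
  (M : lmodType FA) (r : nat) :
  is_twisted_group_algebra tau bar ->
  fin_gen M ->
  gkdim M = ((r%:R : Rdefinitions.R)%:E)%E ->
  (0 < r)%N -> (r <= n.-1)%N ->
  ~ torsion_over bar M (in_first r) ->
  exists (l : 'I_n -> 'rV[int]_n) (s : 'I_n -> int),
    (forall j : 'I_n, (r <= j)%N -> in_first r (l j) /\ s j != 0) /\
    (forall j k : 'I_n, (r <= j)%N -> (r <= k)%N ->
       (bar (l j) * bar (xgen j) ^ s j) * (bar (l k) * bar (xgen k) ^ s k)
       = (bar (l k) * bar (xgen k) ^ s k) * (bar (l j) * bar (xgen j) ^ s j)).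
Proof.
move=> tga _ gk r0 rn1 ntor.
have rn : (r <= n)%N by apply: leq_trans rn1 (leq_pred n).
have [phi [phiD phi_gt0 phi_inj]] := archimedean_character n.
have phi_injB b : in_first r b -> phi b = 1 -> b = 0 by move=> _; exact: phi_inj.
(* A witness to the failure of torsion; Zorn's lemma then enlarges its annihilator to [I]. *)
have [m mfree] : exists m : M, forall y, inFS tga (in_first r) y -> y *: m = 0 -> y = 0.
  apply: contrapT => h; apply: ntor => m; apply: contrapT => hm; apply: h; exists m.
  move=> y By ym; apply/eqP/negPn/negP => y0; apply: hm; exists y; split=> //.
  exact/(in_sub_tgaP tga).
pose good (I : FA -> Prop) := [/\ lideal I, forall y, y *: m = 0 -> I y
  & forall y, inFS tga (in_first r) y -> I y -> y = 0].
have [||I [Ileft annI IB] Imax] := @Zorn_nonempty FA good.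
- exists (fun y => y *: m = 0); split=> //; split; [split|].
  + by rewrite scale0r.
  + by move=> k y z hy hz; rewrite scalerDl -mulr_algl -scalerA hy hz scaler0 addr0.
  + by move=> u y hy; rewrite -scalerA hy scaler0.
- move=> C Cg Ctot [X0 CX0]; split; [split; [split|]| |].
  + by exists X0 => //; case: (Cg _ CX0) => -[[]].
  + move=> k y z [X CX Xy] [Y CY Yz]; have [XY|YX] := Ctot _ _ CX CY.
      exists Y => //; case: (Cg _ CY) => -[[_ h] _] _ _; apply: h => //.
      exact: XY.
    exists X => //; case: (Cg _ CX) => -[[_ h] _] _ _; apply: h => //.
    exact: YX.
  + by move=> u y [X CX Xy]; exists X => //; case: (Cg _ CX) => -[_ h] _ _; apply: h.
  + by move=> y hy; exists X0 => //; case: (Cg _ CX0) => _ h _; apply: h.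
  + by move=> y By [X CX Xy]; case: (Cg _ CX) => _ _; apply.
have ImaxB (I' : FA -> Prop) : lideal I' -> (forall y, I y -> I' y) ->
    (exists2 y, I' y & ~ I y) ->
    exists y, [/\ inFS tga (in_first r) y, y != 0 & I' y].
  move=> lI' II' [y I'y nIy]; apply: contrapT => h; apply: nIy; apply: (Imax I') => //.
  split=> // [z /annI/II' //|z Bz I'z].
  by apply/eqP/negPn/negP => z0; apply: h; exists z.
have n0 : (0 < n)%N by apply: leq_trans r0 rn.
(* As [r > 0], the generator [x_1] lies in [B], and it or its inverse is negative. *)
have ex_neg : exists b, neg r phi b.
  pose x : 'rV[int]_n := xgen (Ordinal n0).
  have xB : in_first r x.
    move=> i ri; rewrite mxE /=; case: eqP => // e.
    by move: ri; rewrite e leqNgt r0.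
  have : phi x != 1.
    apply/eqP => /phi_inj/rowP/(_ (Ordinal n0)); rewrite !mxE !eqxx => /eqP.
    by rewrite oner_eq0.
  rewrite neq_lt => /orP[lt|gt]; first by exists x.
  exists (- x); split; first exact: inBN.
  by rewrite (phiN phiD phi_gt0) invf_lt1.
(* Finite rank leads to the conclusion; an infinite free family makes [M] grow too fast for
   [gkdim M] to be [r]. *)
have [[S1 spanS1]|[s [sball sfree]]] :=
  spanning_or_free (tga := tga) phiD phi_gt0 phi_injB rn Ileft IB.
  exact: (commuting_elements phiD phi_gt0 phi_injB rn Ileft IB ImaxB ex_neg spanS1).
exfalso; apply: (@gkdim_ge _ _ M (unit_ball bar) [:: m] r r0 _ _ gk).
  by rewrite inE eqxx.
by move=> k; exact: FBfree_fdim rn annI sball (sfree k).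
Qed.
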